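(* Let $\{\mathrm{stab}^-_w\mid w\in W\}$ be the K-theoretic stable basis of $(Q_W^m)^*$. Define $p^w_{u,v}\in Q^m$ by $$\mathrm{stab}^-_u\cdot\mathrm{stab}^-_v=\sum_{w\ge u,\ w\ge v}p^w_{u,v}\,\mathrm{stab}^-_w .$$ Then, for any choice of reduced sequence $I_w$ for each $w\in W$, $$p^w_{u,v}=q^{\frac12(\ell(u)+\ell(v)-\ell(w))}\,\hat x_{w_0}\sum P^{I_w}_{E,F}\;c^{\tau^-}_{I_w|_E,\,u}\;c^{\tau^-}_{I_w|_F,\,v},$$ where the sum is over all $E,F\subset[\ell(w)]$ such that $\widetilde\prod(I_w|_E)\ge u$ and $\widetilde\prod(I_w|_F)\ge v$.
   Context: Let $\Sigma\hookrightarrow\Lambda^\vee$ be a semisimple root datum with lattice $\Lambda\supset\Sigma$, simple roots $\alpha_1,\dots,\alpha_n$, and Weyl group $W$ generated by $s_i=s_{\alpha_i}$, with length $\ell$, Bruhat order $\le$ and longest element $w_0$. Write $\alpha>0$ for positive roots and $[k]=\{1,\dots,k\}$. Let $R^m=\mathbb{Z}[q^{1/2},q^{-1/2}]$, $S^m=R^m[\Lambda]$ (group algebra with basis $e^\lambda$, $\lambda\in\Lambda$), $Q^m=\operatorname{Frac}(S^m)$, with $W$ acting by $w(e^\lambda)=e^{w(\lambda)}$ and trivially on $R^m$. $Q^m_W=Q^m\rtimes_{R^m}R^m[W]$ is the free left $Q^m$-module with basis $\{\delta_w\}_{w\in W}$ and product $(p\delta_w)(p'\delta_{w'})=p\,w(p')\,\delta_{ww'}$;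 $\delta_i=\delta_{\alpha_i}=\delta_{s_i}$. It acts on $Q^m$ by $(p\delta_w)\cdot p'=p\,w(p')$. Notation: $\hat x_\alpha=1-qe^{-\alpha}$, $\hat x_w=\prod_{\alpha>0,\,w^{-1}\alpha<0}\hat x_\alpha$ (so $\hat x_{w_0}=\prod_{\alpha>0}(1-qe^{-\alpha})$), $q_w=q^{\ell(w)}$. For a simple root $\alpha$ let $\tau^-_\alpha=\frac{q-1}{1-e^\alpha}+\frac{1-qe^{-\alpha}}{1-e^\alpha}\delta_\alpha\in Q^m_W$. These satisfy the braid relations and $(\tau^-_\alpha)^2=(q-1)\tau^-_\alpha+q$; $\tau^-_w$ denotes the product along any reduced expression of $w$, and $\{\tau^-_w\}_{w\in W}$ is a $Q^m$-basis of $Q^m_W$. For any sequence $I=(i_1,\dots,i_k)$ (not necessarily reduced), $\tau^-_I=\tau^-_{\alpha_{i_1}}\cdots\tau^-_{\alpha_{i_k}}$, and $c^{\tau^-}_{I,w}\in R^m$ are defined by $\tau^-_I=\sum_{w\in W}c^{\tau^-}_{I,w}\tau^-_w$. $(Q^m_W)^*=\operatorname{Hom}_{Q^m}(Q^m_W,Q^m)$ has the basis $\{f_w\}$ dual to $\{\delta_w\}$; it is a commutative ring with $Q^m$-bilinear product $f_wf_v=f_w$ if $w=v$, and $0$ otherwise. $Q^m_W$ acts on it by $\langle z\bullet f,z'\rangle=\langle f,z'z\rangle$. The K-theoretic stable basis is $$\mathrm{stab}^-_w=q_{w_0}\,q_w^{-1/2}\,(\tau^-_{w_0w})^{-1}\bullet\Big(\prod_{\alpha>0}(1-e^\alpha)\,f_{w_0}\Big)\in(Q^m_W)^*,\quad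 w\in W.$$ For a sequence $I=(i_1,\dots,i_k)$ and $E\subset[k]$, $I|_E$ is the subsequence of entries in positions in $E$. The Demazure product $\widetilde\prod I\in W$ is the product $s_{i_1}\cdots s_{i_k}$ computed subject to the braid relations and $s_i^2=s_i$. $I_w$ is a reduced sequence for $w$ if $s_{i_1}\cdots s_{i_k}=w$ is a reduced expression. For $I=(i_1,\dots,i_k)$ and $E,F\subset[k]$, $P^I_{E,F}=(B^{\tau^-}_1\cdots B^{\tau^-}_k)\cdot 1\in Q^m$, where $B^{\tau^-}_j\in Q^m_W$ is $\frac{1-e^{\alpha_{i_j}}}{1-qe^{-\alpha_{i_j}}}\delta_{i_j}$ if $j\in E\cap F$; $\frac{1-q}{1-qe^{-\alpha_{i_j}}}\delta_{i_j}$ if $j$ belongs to exactly one of $E,F$; and $\frac{q-1}{1-qe^{-\alpha_{i_j}}}\tau^-_{\alpha_{i_j}}\delta_{i_j}$ if $j\notin E\cup F$. *)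

(* Defs.v *)
From HB Require Import structures.
From mathcomp Require Import all_boot all_order all_algebra all_fingroup.
From mathcomp Require Import finmap.
From mathcomp Require Import boolp.
From mathcomp Require Import monalg.

Set Implicit Arguments.
Unset Strict Implicit.
Unset Printing Implicit Defensive.

Import Order.TTheory GRing.Theory Num.Theory.
Local Open Scope ring_scope.

Definition grpalg (R : idomainType) (r : nat) := {malg R['cV[int]_r]}.
HB.instance Definition _ (R : idomainType) (r : nat) :=
  GRing.Zmodule.copy (grpalg R r) {malg R['cV[int]_r]}.

HB.lock Definition gmon (R : idomainType) (r : nat) (c : R) (k : 'cV[int]_r) :
  grpalg R r := << c *g k >>.

HB.lock Definition gmul (R : idomainType) (r : nat) (g h : grpalg R r) :
    grpalg R r :=
  \sum_(k <- msupp g) \sum_(l <- msupp h) gmon (g@_k * h@_l) (k + l).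

HB.lock Definition gact (R : idomainType) (r : nat) (M : 'M[int]_r)
    (g : grpalg R r) : grpalg R r :=
  \sum_(k <- msupp g) gmon g@_k (M *m k).

Section GroupRing.
Context (R : idomainType) (r : nat).
Local Notation grpalg := (grpalg R r).
Local Notation gmon := (@gmon R r).
Local Notation gmul := (@gmul R r).
Local Notation gact := (@gact R r).

Implicit Types (g h : grpalg) (k l : 'cV[int]_r).

Definition gone : grpalg := gmon 1 0.

Lemma mcoeff_gmon c k l : (gmon c k)@_l = c *+ (k == l).
Proof. by rewrite gmon.unlock mcoeffU. Qed.
Lemma gmon0 k : gmon 0 k = 0.
Proof. by rewrite gmon.unlock monalgU0. Qed.
Lemma gmonD k : {morph gmon^~ k : x y / x + y}.
Proof. by move=> x y; rewrite gmon.unlock monalgUD. Qed.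

Lemma extw (V : zmodType) (f : 'cV[int]_r -> R -> V) (d : {fset 'cV[int]_r}) g :
  (forall k, f k 0 = 0) -> (msupp g `<=` d)%fset ->
  \sum_(k <- msupp g) f k g@_k = \sum_(k <- d) f k g@_k.
Proof.
move=> f0 gd; apply: big_fset_incl => // k _ /mcoeff_outdom ->; exact: f0.
Qed.

Lemma extD (V : zmodType) (f : 'cV[int]_r -> R -> V) g h :
  (forall k, {morph f k : x y / x + y}) ->
  \sum_(k <- msupp (g + h)) f k (g + h)@_k
   = \sum_(k <- msupp g) f k g@_k + \sum_(k <- msupp h) f k h@_k.
Proof.
move=> fD; have f0 k : f k 0 = 0.
  by apply: (addIr (f k 0)); rewrite -fD !add0r.
rewrite (extw f0 (msuppD_le g h)) (extw f0 (fsubsetUl _ (msupp h))).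
rewrite (extw (g := h) f0 (fsubsetUr (msupp g) _)) -big_split /=.
by apply: eq_bigr => k _; rewrite mcoeffD fD.
Qed.

Lemma extU (V : zmodType) (f : 'cV[int]_r -> R -> V) k x :
  (forall k, f k 0 = 0) ->
  \sum_(l <- msupp (gmon x k)) f l (gmon x k)@_l = f k x.
Proof.
by move=> f0; rewrite gmon.unlock (extw f0 msuppU_le) big_seq_fset1 mcoeffUU.
Qed.

Lemma gmulDl : left_distributive gmul +%R.
Proof.
move=> a b c; rewrite gmul.unlock.
rewrite (extD (f := fun k x => \sum_(l <- msupp c) gmon (x * c@_l) (k + l))) //.
move=> k x y; rewrite -big_split; apply: eq_bigr => l _.
by rewrite mulrDl gmonD.
Qed.

Lemma gmulC : commutative gmul.
Proof.
move=> g h; rewrite gmul.unlock exchange_big; apply: eq_bigr => k _.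
by apply: eq_bigr => l _; rewrite mulrC addrC.
Qed.

Lemma gmulDr : right_distributive gmul +%R.
Proof. by move=> a b c; rewrite ![gmul a _]gmulC gmulDl. Qed.

Lemma gmul0 : left_zero (0 : grpalg) gmul.
Proof. by move=> g; rewrite gmul.unlock msupp0 big_seq_fset0. Qed.

Lemma gmulg0 : right_zero (0 : grpalg) gmul.
Proof. by move=> g; rewrite gmulC gmul0. Qed.

Lemma gmulUU x y k l : gmul (gmon x k) (gmon y l) = gmon (x * y) (k + l).
Proof.
rewrite gmul.unlock (extU (f := fun k' x' => \sum_(l' <- msupp (gmon y l))
  gmon (x' * (gmon y l)@_l') (k' + l'))).
  rewrite (extU (f := fun l' y' => gmon (x * y') (k + l'))) //.
  by move=> ?; rewrite mulr0 gmon0.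
by move=> ?; rewrite big1 // => *; rewrite mul0r gmon0.
Qed.

Lemma grpalg_ind (P : grpalg -> Prop) :
  P 0 -> (forall g h, P g -> P h -> P (g + h)) ->
  (forall x k, P (gmon x k)) -> forall g, P g.
Proof.
move=> P0 PD PU g; rewrite (monalgE g); elim/big_rec: _ => // k h _ Ph.
by apply: PD => //; have := PU g@_k k; rewrite gmon.unlock.
Qed.

Lemma eq_grpalg (V : zmodType) (F G : grpalg -> V) :
  {morph F : x y / x + y} -> {morph G : x y / x + y} ->
  (forall x k, F (gmon x k) = G (gmon x k)) -> F =1 G.
Proof.
move=> FD GD FG; have F0 : F 0 = 0 by apply: (addIr (F 0)); rewrite -FD !add0r.
have G0 : G 0 = 0 by apply: (addIr (G 0)); rewrite -GD !add0r.
by elim/grpalg_ind => [|g h IH IH'|//]; rewrite ?F0 ?G0 // FD GD IH IH'.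
Qed.

Lemma gmulA : associative gmul.
Proof.
move=> a b c; pose F3 x y z := gmul x (gmul y z).
pose G3 x y z := gmul (gmul x y) z; rewrite -/(F3 a b c) -/(G3 a b c).
have FD1 y z : {morph F3^~ y ^~ z : u v / u + v}.
  by move=> u v; exact: gmulDl.
have FD2 x z : {morph (F3 x)^~ z : u v / u + v}.
  by move=> u v; rewrite /F3 (gmulDl u v z); exact: gmulDr.
have FD3 x y : {morph F3 x y : u v / u + v}.
  by move=> u v; rewrite /F3 (gmulDr y u v); exact: gmulDr.
have GD1 y z : {morph G3^~ y ^~ z : u v / u + v}.
  by move=> u v; rewrite /G3 (gmulDl u v y); exact: gmulDl.
have GD2 x z : {morph (G3 x)^~ z : u v / u + v}.
  by move=> u v; rewrite /G3 (gmulDr x u v); exact: gmulDl.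
have GD3 x y : {morph G3 x y : u v / u + v}.
  by move=> u v; exact: gmulDr.
refine (eq_grpalg (FD1 b c) (GD1 b c) _ a) => x k.
refine (eq_grpalg (FD2 _ c) (GD2 _ c) _ b) => y l.
refine (eq_grpalg (FD3 _ _) (GD3 _ _) _ c) => z m.
by rewrite /F3 /G3 (gmulUU y z) (gmulUU x y) (gmulUU x) (gmulUU (x * y)) mulrA addrA.
Qed.

Lemma gmul1 : left_id gone gmul.
Proof.
move=> g; refine (eq_grpalg (F := gmul gone) (G := id) _ _ _ g) => [||x k] //.
  exact: gmulDr.
by rewrite gmulUU mul1r add0r.
Qed.

Lemma gone_neq0 : gone != 0.
Proof. by rewrite /gone gmon.unlock monalgU_eq0 oner_eq0. Qed.

HB.instance Definition _ := GRing.Zmodule_isComNzRing.Build grpalg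
  gmulA gmulC gmul1 gmulDl gone_neq0.


Lemma gmulE g h : g * h = gmul g h. Proof. by []. Qed.

Let lexlt k l := [exists i, (k i 0 < l i 0) && [forall j : 'I_r, (j < i)%N ==> (k j 0 == l j 0)]].

Let lexlt_trans : transitive lexlt.
Proof.
move=> y x z /existsP[i /andP[xy /forallP Hxy]] /existsP[j /andP[yz /forallP Hyz]].
have {}Hxy (m : 'I_r) : (m < i)%N -> x m 0 = y m 0 by move=> h; have := Hxy m; rewrite h => /eqP.
have {}Hyz (m : 'I_r) : (m < j)%N -> y m 0 = z m 0 by move=> h; have := Hyz m; rewrite h => /eqP.
apply/existsP; case: (ltngtP i j) => ij.
- exists i; rewrite -(Hyz i ij) xy; apply/forallP => m; apply/implyP => mi.
  by rewrite Hxy // Hyz // (ltn_trans mi).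
- exists j; rewrite (Hxy j ij) yz; apply/forallP => m; apply/implyP => mi.
  by rewrite Hxy ?Hyz // (ltn_trans mi).
have {ij} ij : i = j by apply: val_inj.
subst j; exists i; rewrite (lt_trans xy yz); apply/forallP => m; apply/implyP => mi.
by rewrite Hxy // Hyz.
Qed.

Let lexlt_irr k : lexlt k k = false.
Proof. by apply/existsP => -[i]; rewrite ltxx. Qed.

Let lexlt_total k l : k != l -> lexlt k l || lexlt l k.
Proof.
move=> kl; have [i Hi] : exists i, k i 0 != l i 0.
  apply/existsP; apply: contraNT kl; rewrite negb_exists => /forallP H.
  by apply/eqP/matrixP => i j; rewrite ord1; have := H i; rewrite negbK => /eqP.
pose m := [arg min_(j < i | k j 0 != l j 0) (j : nat)].
have [Hm mmin] : k m 0 != l m 0 /\ forall j : 'I_r, (j < m)%N -> k j 0 = l j 0.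
  rewrite /m; case: arg_minnP => // j Hj jmin; split=> // j' j'j.
  by apply/eqP; apply: contraTT j'j => /jmin; rewrite -leqNgt.
have [lt|lt|eq] := ltgtP (k m 0) (l m 0); last by rewrite eq eqxx in Hm.
  apply/orP; left; apply/existsP; exists m; rewrite lt; apply/forallP => j.
  by apply/implyP => /mmin ->.
apply/orP; right; apply/existsP; exists m; rewrite lt; apply/forallP => j.
by apply/implyP => /mmin ->.
Qed.

Let lexlt_add p k l : lexlt k l -> lexlt (p + k) (p + l).
Proof.
case/existsP=> i /andP[kl /forallP H]; apply/existsP; exists i.
rewrite !mxE ltrD2l kl; apply/forallP => j; apply/implyP => ji.
by have := H j; rewrite ji !mxE => /eqP ->.
Qed.

Let lead g : g != 0 ->
  exists2 k, g@_k != 0 & forall l, g@_l != 0 -> l = k \/ lexlt l k.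
Proof.
move=> g0; have : (msupp g : seq _) != [::].
  apply: contra g0 => /eqP g0; apply/eqP/malgP => k; rewrite mcoeff0.
  by apply: mcoeff_outdom; rewrite -[_ \in _]/(k \in (msupp g : seq _)) g0.
have H (s : seq 'cV[int]_r) : s != [::] ->
    exists2 k, k \in s & forall l, l \in s -> l = k \/ lexlt l k.
  elim: s => // a [|b s] IH _; first by exists a => [|l]; rewrite inE // => /eqP ->; left.
  have [//|k ks kmax] := IH.
  case: (altP (a =P k)) => [->|ak].
    exists k; rewrite ?inE ?eqxx // => l; rewrite inE => /orP[/eqP ->|/kmax //]; by left.
  case/orP: (lexlt_total ak) => ltak.
    exists k => [|l]; rewrite inE ?ks ?orbT // => /orP[/eqP ->|/kmax //]; by right.
  exists a => [|l]; rewrite inE ?eqxx // => /orP[/eqP ->|]; first by left.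
  by move=> /kmax [->|h]; right=> //; exact: lexlt_trans ltak.
by case/H => k; rewrite -mcoeff_neq0 => gk kmax; exists k => // l gl; apply: kmax; rewrite -mcoeff_neq0.
Qed.

Lemma grpalg_integral : GRing.integral_domain_axiom grpalg.
Proof.
move=> g h gh0; apply/norP => -[/lead[k gk kmax] /lead[l hl lmax]].
move/(congr1 (mcoeff (k + l))): gh0; rewrite gmulE gmul.unlock mcoeff0 raddf_sum /=.
rewrite (big_fsetD1 k) -?mcoeff_neq0 //= raddf_sum (big_fsetD1 l) -?mcoeff_neq0 //=.
rewrite mcoeff_gmon eqxx big1_fset ?addr0; last first.
  move=> l'; rewrite !inE /= mcoeff_gmon => /andP[l'l _] _; case: eqP => //.
  by move/addrI => e; rewrite e eqxx in l'l.
rewrite big1_fset ?addr0 => [/eqP|]; first by rewrite mulf_eq0 (negPf gk) (negPf hl).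
move=> k'; rewrite !inE -mcoeff_neq0 => /andP[k'k gk'] _.
rewrite raddf_sum big1_fset // => l'; rewrite -mcoeff_neq0 => hl' _.
rewrite /= mcoeff_gmon; case: eqP => // e; have := lexlt_irr (k + l).
have kk : lexlt k' k by case: (kmax _ gk') => // e'; rewrite e' eqxx in k'k.
suff -> : lexlt (k + l) (k + l) by [].
rewrite -{1}e; case: (lmax _ hl') => [->|ll].
  by rewrite ![_ + l]addrC lexlt_add.
by apply: (@lexlt_trans (k' + l)); [|rewrite ![_ + l]addrC]; exact: lexlt_add.
Qed.

Definition gunit : pred grpalg := fun x => `[< exists y, y * x = 1 >].
Definition ginv (x : grpalg) : grpalg :=
  if pselect (exists y, y * x = 1) is left H then projT1 (cid H) else x.

Fact gmulVx : {in gunit, left_inverse 1 ginv *%R}.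
Proof.
move=> x /asboolP H; rewrite /ginv; case: pselect => // H'; exact: (projT2 (cid H')).
Qed.
Fact gunitPl x y : y * x = 1 -> gunit x.
Proof. by move=> e; apply/asboolP; exists y. Qed.
Fact ginv_out : {in [predC gunit], ginv =1 id}.
Proof. by move=> x /asboolP H; rewrite /ginv; case: pselect. Qed.

HB.instance Definition _ := GRing.ComNzRing_hasMulInverse.Build grpalg
  gmulVx gunitPl ginv_out.
HB.instance Definition _ := GRing.ComUnitRing_isIntegral.Build grpalg
  grpalg_integral.

Definition gexp k : grpalg := gmon 1 k.
Definition gcst (c : R) : grpalg := gmon c 0.

Lemma gexp0 : gexp 0 = 1. Proof. by []. Qed.
Lemma gexpD k l : gexp (k + l) = gexp k * gexp l.
Proof. by rewrite gmulE gmulUU mulr1. Qed.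
Fact gcst_additive : zmod_morphism gcst.
Proof. by move=> x y; rewrite /gcst gmon.unlock raddfB. Qed.
Fact gcst_multiplicative : monoid_morphism gcst.
Proof. by split=> // x y; rewrite gmulE gmulUU addr0. Qed.
HB.instance Definition _ := GRing.isZmodMorphism.Build R grpalg gcst gcst_additive.
HB.instance Definition _ := GRing.isMonoidMorphism.Build R grpalg gcst
  gcst_multiplicative.

Lemma gactU M x k : gact M (gmon x k) = gmon x (M *m k).
Proof.
by rewrite gact.unlock (extU (f := fun k x => gmon x (M *m k))) // => ?; exact: gmon0.
Qed.

Fact gactD M : {morph gact M : g h / g + h}.
Proof.
move=> g h; rewrite gact.unlock (extD (f := fun k x => gmon x (M *m k))) // => k x y.
exact: gmonD.
Qed.

Lemma gact0 M : gact M 0 = 0.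
Proof. by rewrite gact.unlock msupp0 big_seq_fset0. Qed.

Fact gact_additive M : zmod_morphism (gact M).
Proof.
move=> g h; rewrite gactD; congr (_ + _); apply: (addIr (gact M h)).
by rewrite -gactD !addNr gact0.
Qed.

Fact gact_multiplicative M : monoid_morphism (gact M).
Proof.
split; first by rewrite gactU mulmx0.
move=> g h.
refine (eq_grpalg (F := fun g => gact M (g * h)) (G := fun g => gact M g * gact M h) _ _ _ g).
- by move=> x y; rewrite mulrDl gactD.
- by move=> x y; rewrite gactD mulrDl.
move=> x k.
refine (eq_grpalg (F := fun h => gact M (gmon x k * h))
  (G := fun h => gact M (gmon x k) * gact M h) _ _ _ h).
- by move=> y z; rewrite mulrDr gactD.
- by move=> y z; rewrite gactD mulrDr.
by move=> y l; rewrite !gmulE (gmulUU x y) !gactU (gmulUU x y) mulmxDr.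
Qed.
HB.instance Definition _ M := GRing.isZmodMorphism.Build grpalg grpalg (gact M)
  (gact_additive M).
HB.instance Definition _ M := GRing.isMonoidMorphism.Build grpalg grpalg (gact M)
  (gact_multiplicative M).

Lemma gact1 g : gact 1%:M g = g.
Proof.
refine (eq_grpalg (F := gact _) (G := id) _ _ _ g) => // [|x k]; first exact: gactD.
by rewrite gactU mul1mx.
Qed.

Lemma gactM M N g : gact (M *m N) g = gact M (gact N g).
Proof.
refine (eq_grpalg (F := gact _) (G := fun g => gact M (gact N g)) _ _ _ g).
- exact: gactD.
- by move=> x y; rewrite !gactD.
by move=> x k; rewrite !gactU mulmxA.
Qed.

End GroupRing.

Section FracMap.
Context (A : idomainType) (f : {rmorphism A -> A}).
Hypothesis f_inj : injective f.

Local Notation "x %:F" := (@FracField.tofrac A x).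

Local Notation num x := \n_(generic_quotient.repr x).
Local Notation den x := \d_(generic_quotient.repr x).

Definition fracmap (x : {fraction A}) : {fraction A} :=
  (f (num x))%:F / (f (den x))%:F.

Lemma frac_numden (x : {fraction A}) :
  x = (num x)%:F / (den x)%:F.
Proof.
rewrite -[LHS](generic_quotient.reprK x); move: (generic_quotient.repr x) => b; have b0 := denom_ratioP b.
rewrite -[RHS]/(FracField.mul _ (FracField.inv _)) !piE.
apply/eqP; rewrite FracField.equivf_def. 
rewrite /FracField.mulf /FracField.invf.
by rewrite !numden_Ratio ?oner_neq0 ?mul1r ?mulr1 ?mulf_neq0 // mulrC.
Qed.

Lemma fracmapE a b : b != 0 -> fracmap (a%:F / b%:F) = (f a)%:F / (f b)%:F.
Proof.
move=> b0; pose x := a%:F / b%:F; rewrite /fracmap -/x; have d0 := denom_ratioP (generic_quotient.repr x).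
have f0 c : c != 0 -> (f c)%:F != 0 :> {fraction A}.
  by move=> c0; rewrite tofrac_eq0 -(rmorph0 f) (inj_eq f_inj).
apply/eqP; rewrite eqr_div ?f0 //.  rewrite -!tofracM tofrac_eq -!rmorphM; apply/eqP; congr (f _).
apply/eqP; rewrite -tofrac_eq !tofracM -eqr_div ?tofrac_eq0 //.
by rewrite -frac_numden.
Qed.

Lemma fracmap_tofrac a : fracmap a%:F = (f a)%:F.
Proof. by rewrite -[a%:F]divr1 -tofrac1 fracmapE ?oner_neq0 // rmorph1 tofrac1 divr1. Qed.

Lemma fracmapD : {morph fracmap : x y / x + y}.
Proof.
move=> x y; rewrite (frac_numden x) (frac_numden y).
move: (denom_ratioP (generic_quotient.repr x)) (denom_ratioP (generic_quotient.repr y)).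
move: (num x) (den x) (num y) (den y) => a b c d b0 d0.
have f0 c' : c' != 0 -> (f c')%:F != 0 :> {fraction A}.
  by move=> c0; rewrite tofrac_eq0 -(rmorph0 f) (inj_eq f_inj).
rewrite addf_div ?tofrac_eq0 // -!tofracM -tofracD !fracmapE ?mulf_neq0 //.
by rewrite addf_div ?f0 // !rmorphD !rmorphM.
Qed.

Lemma fracmapM : {morph fracmap : x y / x * y}.
Proof.
move=> x y; rewrite (frac_numden x) (frac_numden y).
move: (denom_ratioP (generic_quotient.repr x)) (denom_ratioP (generic_quotient.repr y)).
move: (num x) (den x) (num y) (den y) => a b c d b0 d0.
by rewrite mulf_div -!tofracM !fracmapE ?mulf_neq0 // mulf_div !rmorphM.
Qed.

Lemma fracmap1 : fracmap 1 = 1.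
Proof. by rewrite -tofrac1 fracmap_tofrac rmorph1. Qed.
End FracMap.

Record root_datum := RootDatum {
  rk : nat;
  nroots : nat;
  root : 'I_nroots -> 'cV[int]_rk;
  coroot : 'I_nroots -> 'rV[int]_rk;
  root_inj : injective root;
  coroot_inj : injective coroot;
  coroot_root : forall a, (coroot a *m root a) 0 0 = 2;
  root_refl : forall a b, exists c,
    root c = root b - (coroot a *m root b) 0 0 *: root a;
  coroot_refl : forall a b, exists c,
    coroot c = coroot b - (coroot b *m root a) 0 0 *: coroot a;
  root_reduced : forall a b, root b <> root a *+ 2;
  root_semisimple :
    row_full (\matrix_(a < nroots) map_mx (intr : int -> rat) (root a)^T);
  nsimple : nat;
  simple : 'I_nsimple -> 'I_nroots;
  simple_free :
    row_free (\matrix_(i < nsimple) map_mx (intr : int -> rat) (root (simple i))^T);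
  simple_base : forall a, exists c : 'I_nsimple -> nat,
    root a = \sum_i root (simple i) *+ c i \/
    root a = - \sum_i root (simple i) *+ c i
}.

Section WeylGroup.
Context (D : root_datum).
Local Notation r := (rk D).
Local Notation n := (nsimple D).

Definition refl_mx (a : 'I_(nroots D)) : 'M[int]_r := 1%:M - root a *m coroot a.

Lemma refl_mxE a v : refl_mx a *m v = v - (coroot a *m v) 0 0 *: root a.
Proof.
rewrite mulmxBl mul1mx -mulmxA [coroot a *m v]mx11_scalar mul_mx_scalar.
by rewrite [X in _ = _ - X *: _]mxE eqxx mulr1n.
Qed.

Definition word_mx (I : seq 'I_n) : 'M[int]_r := \prod_(i <- I) refl_mx (simple i).

Record weyl := Weyl {
  weyl_mx : 'M[int]_r;
  weyl_mxP : `[< exists I : seq 'I_n, weyl_mx = word_mx I >]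
}.
HB.instance Definition _ := [isSub for weyl_mx].
HB.instance Definition _ := [Countable of weyl by <:].


Lemma refl_mx2 a : refl_mx a *m refl_mx a = 1%:M.
Proof.
have cr : coroot a *m root a = 2%:M by rewrite [LHS]mx11_scalar coroot_root.
rewrite /refl_mx mulmxBl mul1mx mulmxBr mulmx1 -mulmxA [coroot a *m (_ *m _)]mulmxA.
by rewrite cr mul_scalar_mx -scalemxAr scaler_nat mulr2n opprB addrK subrK.
Qed.

Lemma word_mx_cons i I : word_mx (i :: I) = refl_mx (simple i) *m word_mx I.
Proof. exact: big_cons. Qed.

Lemma word_mx_cat I J : word_mx (I ++ J) = word_mx I *m word_mx J.
Proof. exact: big_cat. Qed.

Lemma word_mx_rev I : word_mx (rev I) *m word_mx I = 1%:M.
Proof.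
elim: I => [|i I IH]; first by rewrite /word_mx big_nil mul1mx.
rewrite rev_cons -cats1 word_mx_cat !word_mx_cons {2}/word_mx big_nil mulmx1.
by rewrite -mulmxA [refl_mx _ *m (_ *m _)]mulmxA refl_mx2 mul1mx.
Qed.

Lemma word_mx_root I b : exists c, root c = word_mx I *m root b.
Proof.
elim: I => [|i I [c Hc]]; first by exists b; rewrite /word_mx big_nil mul1mx.
have [d Hd] := root_refl (simple i) c.
by exists d; rewrite word_mx_cons -mulmxA -Hc refl_mxE.
Qed.

Definition weyl_perm (w : weyl) : {ffun 'I_(nroots D) -> 'I_(nroots D)} :=
  [ffun b => odflt b [pick c | root c == weyl_mx w *m root b]].

Lemma weyl_permE w b : root (weyl_perm w b) = weyl_mx w *m root b.
Proof.
rewrite ffunE; case: pickP => [c /eqP //|H] /=; have /asboolP[I wI] := weyl_mxP w.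
by have [c Hc] := word_mx_root I b; have := H c; rewrite wI Hc eqxx.
Qed.

Lemma weyl_perm_inj : injective weyl_perm.
Proof.
move=> w w' e; apply: val_inj => /=; have /row_fullP[B BA] := root_semisimple D.
set A := (X in B *m X) in BA; pose m := map_mx (intr : int -> rat).
suff : A *m (m _ _ (weyl_mx w))^T = A *m (m _ _ (weyl_mx w'))^T.
  move/(congr1 (mulmx B)); rewrite !mulmxA BA !mul1mx => /trmx_inj.
  move/matrixP=> H; apply/matrixP => i j; have := H i j; rewrite !mxE.
  exact: intr_inj.
apply/row_matrixP => a; rewrite !row_mul rowK /m !map_trmx -!map_mxM -!trmx_mul.
by rewrite -!weyl_permE e.
Qed.

Definition weyl_unperm (f : {ffun 'I_(nroots D) -> 'I_(nroots D)}) : option weyl :=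
  if pselect (exists w, weyl_perm w = f) is left H then Some (projT1 (cid H)) else None.

Lemma weyl_permK : pcancel weyl_perm weyl_unperm.
Proof.
move=> w; rewrite /weyl_unperm; case: pselect => [H|[]]; last by exists w.
by congr Some; apply: weyl_perm_inj; exact: (projT2 (cid H)).
Qed.

Fact weyl_isFinite : isFinite weyl. Proof. exact: PCanIsFinite weyl_permK. Qed.
HB.instance Definition _ := weyl_isFinite.

Fact weyl_mul_subproof (w w' : weyl) :
  `[< exists I, weyl_mx w *m weyl_mx w' = word_mx I >].
Proof.
have /asboolP[I ->] := weyl_mxP w; have /asboolP[J ->] := weyl_mxP w'.
by apply/asboolP; exists (I ++ J); rewrite word_mx_cat.
Qed.
Definition weyl_mul w w' := Weyl (weyl_mul_subproof w w').

Fact weyl_one_subproof : `[< exists I, 1%:M = word_mx I >].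
Proof. by apply/asboolP; exists [::]; rewrite /word_mx big_nil. Qed.
Definition weyl_one := Weyl weyl_one_subproof.

Fact weyl_inv_subproof (w : weyl) : exists w', weyl_mul w' w = weyl_one.
Proof.
have /asboolP[I wI] := weyl_mxP w.
have H : `[< exists J, word_mx (rev I) = word_mx J >] by apply/asboolP; exists (rev I).
by exists (Weyl H); apply: val_inj; rewrite /= wI word_mx_rev.
Qed.
Definition weyl_inv (w : weyl) : weyl := projT1 (cid (weyl_inv_subproof w)).

Fact weyl_mulA : associative weyl_mul.
Proof. by move=> u v w; apply: val_inj; rewrite /= mulmxA. Qed.
Fact weyl_mul1 : left_id weyl_one weyl_mul.
Proof. by move=> w; apply: val_inj; rewrite /= mul1mx. Qed.
Fact weyl_mulV : left_inverse weyl_one weyl_inv weyl_mul.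
Proof. by move=> w; exact: (projT2 (cid (weyl_inv_subproof w))). Qed.

HB.instance Definition _ := Finite_isGroup.Build weyl weyl_mulA weyl_mul1 weyl_mulV.

Fact srefl_subproof i : `[< exists I, refl_mx (simple i) = word_mx I >].
Proof. by apply/asboolP; exists [:: i]; rewrite /word_mx big_seq1. Qed.
Definition srefl (i : 'I_n) : weyl := Weyl (srefl_subproof i).

Definition word_prod (I : seq 'I_n) : weyl := (\prod_(i <- I) srefl i)%g.

Lemma weyl_mx_prod I : weyl_mx (word_prod I) = word_mx I.
Proof.
rewrite /word_prod; elim: I => [|i I IH]; first by rewrite /word_mx !big_nil.
by rewrite big_cons word_mx_cons -IH.
Qed.

Lemma word_prod_surj w : exists k, [exists t : k.-tuple 'I_n, word_prod t == w].
Proof.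
have /asboolP[I wI] := weyl_mxP w; exists (size I); apply/existsP.
by exists (in_tuple I); apply/eqP/val_inj; rewrite /= weyl_mx_prod wI.
Qed.

Definition len (w : weyl) : nat := ex_minn (word_prod_surj w).

Definition reduced_word (I : seq 'I_n) (w : weyl) : bool :=
  (word_prod I == w) && (size I == len w).

Lemma red_subproof w : [exists t : (len w).-tuple 'I_n, word_prod t == w].
Proof. by rewrite /len; case: ex_minnP. Qed.

Definition redword (w : weyl) : seq 'I_n := xchoose (existsP (red_subproof w)).

Lemma redwordP w : reduced_word (redword w) w.
Proof.
rewrite /reduced_word size_tuple eqxx andbT.
exact: (xchooseP (existsP (red_subproof w))).
Qed.

Definition is_refl (t : weyl) : bool := [exists a, weyl_mx t == refl_mx a].

Definition bruhat_step (u v : weyl) : bool :=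
  (len u < len v)%N && [exists t, is_refl t && (v == t * u)%g].

Definition bruhat (u v : weyl) : bool := connect bruhat_step u v.

Definition w0 : weyl := [arg max_(w > 1%g) len w].

Definition positive_vec (x : 'cV[int]_r) : bool :=
  `[< exists c : 'I_n -> nat, x = \sum_i root (simple i) *+ c i >].

Definition posroot (a : 'I_(nroots D)) : bool := positive_vec (root a).

Definition alternating (i j : 'I_n) (m : nat) : seq 'I_n :=
  [seq if odd k then j else i | k <- iota 0 m].

Inductive hecke0_eq : seq 'I_n -> seq 'I_n -> Prop :=
| Hecke0_refl I : hecke0_eq I I
| Hecke0_sym I J : hecke0_eq I J -> hecke0_eq J I
| Hecke0_trans I J K : hecke0_eq I J -> hecke0_eq J K -> hecke0_eq I K
| Hecke0_idem I J i : hecke0_eq (I ++ [:: i; i] ++ J) (I ++ [:: i] ++ J)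
| Hecke0_braid I J i j (m := #[srefl i * srefl j]%g) :
    hecke0_eq (I ++ alternating i j m ++ J) (I ++ alternating j i m ++ J).

Definition demazure (I : seq 'I_n) : weyl :=
  odflt 1%g [pick w | `[< exists2 J, reduced_word J w & hecke0_eq I J >]].

End WeylGroup.

Definition Rm : idomainType := grpalg int 1.
Definition Sm (D : root_datum) : idomainType := grpalg Rm (rk D).
Definition Qm (D : root_datum) : fieldType := {fraction Sm D}.

HB.lock Definition cstQ (D : root_datum) (c : Rm) : Qm D :=
  FracField.tofrac (gcst _ c).
HB.lock Definition eQ (D : root_datum) (x : 'cV[int]_(rk D)) : Qm D :=
  FracField.tofrac (gexp _ x).
HB.lock Definition actQ (D : root_datum) (w : weyl D) : Qm D -> Qm D :=
  fracmap (gact (weyl_mx w)).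

Section CoefficientField.
Context (D : root_datum).
Local Notation W := (weyl D).
Local Notation n := (nsimple D).
Local Notation Q := (Qm D).

Local Notation cstQ := (@cstQ D).
Local Notation eQ := (@eQ D).
Local Notation actQ := (@actQ D).

Definition qh : Q := cstQ (gexp _ (const_mx 1)).
Definition q : Q := qh ^+ 2.

Lemma gact_inj (w : W) : injective (gact (R := Rm) (weyl_mx w)).
Proof.
apply: (can_inj (g := gact (weyl_mx w^-1%g))) => g.
by rewrite -gactM -[_ *m _]/(weyl_mx (w^-1 * w)%g) mulVg gact1.
Qed.

Lemma actQ_tofrac w g : actQ w (FracField.tofrac g) = FracField.tofrac (gact (weyl_mx w) g).
Proof. rewrite actQ.unlock; exact/fracmap_tofrac/gact_inj. Qed.
Lemma actQ_eQ w x : actQ w (eQ x) = eQ (weyl_mx w *m x).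
Proof. by rewrite eQ.unlock actQ_tofrac gactU. Qed.
Lemma actQ_cst w c : actQ w (cstQ c) = cstQ c.
Proof. by rewrite cstQ.unlock actQ_tofrac gactU mulmx0. Qed.

Lemma eQ0 : eQ 0 = 1.
Proof. by rewrite eQ.unlock gexp0 tofrac1. Qed.
Lemma eQD x y : eQ (x + y) = eQ x * eQ y.
Proof. by rewrite eQ.unlock gexpD tofracM. Qed.

Fact cstQ_additive : zmod_morphism cstQ.
Proof. by move=> x y; rewrite cstQ.unlock rmorphB tofracB. Qed.
Fact cstQ_multiplicative : monoid_morphism cstQ.
Proof. by rewrite cstQ.unlock; split=> [|x y]; rewrite ?rmorph1 ?tofrac1 // rmorphM tofracM. Qed.
HB.instance Definition _ := GRing.isZmodMorphism.Build Rm Q cstQ cstQ_additive.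
HB.instance Definition _ := GRing.isMonoidMorphism.Build Rm Q cstQ cstQ_multiplicative.

Fact actQ_additive w : zmod_morphism (actQ w).
Proof.
have D' := fracmapD (gact_inj (w := w)); have := D' 0 0.
rewrite addr0 -[LHS]addr0 => /addrI /esym a0 x y.
rewrite actQ.unlock D'; congr (_ + _).
by apply: (addIr (fracmap (gact (weyl_mx w)) y)); rewrite -D' !addNr.
Qed.
Fact actQ_multiplicative w : monoid_morphism (actQ w).
Proof.
by rewrite actQ.unlock; split; [exact/fracmap1/gact_inj | exact/fracmapM/gact_inj].
Qed.
HB.instance Definition _ w := GRing.isZmodMorphism.Build Q Q (actQ w) (actQ_additive w).
HB.instance Definition _ w := GRing.isMonoidMorphism.Build Q Q (actQ w) (actQ_multiplicative w).

Lemma actQ_mul u v x : actQ (u * v)%g x = actQ u (actQ v x).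
Proof.
rewrite (frac_numden x) !fmorph_div /= !actQ_tofrac.
by congr (FracField.tofrac _ / FracField.tofrac _); exact: gactM.
Qed.
Lemma actQ1 x : actQ 1%g x = x.
Proof.
rewrite [RHS]frac_numden actQ.unlock.
by congr (FracField.tofrac _ / FracField.tofrac _); exact: gact1.
Qed.

End CoefficientField.

Definition twisted (D : root_datum) := {ffun weyl D -> (Qm D)^o}.
HB.instance Definition _ (D : root_datum) :=
  Vector.copy (twisted D) {ffun weyl D -> (Qm D)^o}.

HB.lock Definition delta (D : root_datum) (w : weyl D) : twisted D :=
  [ffun v => (v == w)%:R].

HB.lock Definition twmul (D : root_datum) (x y : twisted D) : twisted D :=
  [ffun w => \sum_v x v * actQ v (y (v^-1 * w)%g)].

Section TwistedRing.
Context (D : root_datum).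
Local Notation W := (weyl D).
Local Notation Q := (Qm D).
Local Notation twisted := (twisted D).
Local Notation actQ := (@actQ D).
Local Notation delta := (@delta D).
Local Notation twmul := (@twmul D).

Lemma deltaE w v : delta w v = (v == w)%:R.
Proof. by rewrite delta.unlock ffunE. Qed.
Lemma twmulE x y w : twmul x y w = \sum_v x v * actQ v (y (v^-1 * w)%g).
Proof. by rewrite twmul.unlock ffunE. Qed.
Lemma twaddE (x y : twisted) w : (x + y) w = x w + y w.
Proof. exact: ffunE. Qed.
Lemma twscaleE (a : Q) (x : twisted) w : (a *: x) w = a * x w.
Proof. exact: ffunE. Qed.

Fact twmulA : associative twmul.
Proof.
move=> x y z; apply/ffunP => w; rewrite !twmulE.
under eq_bigr do rewrite twmulE rmorph_sum mulr_sumr.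
under [RHS]eq_bigr do rewrite twmulE mulr_suml.
rewrite [RHS]exchange_big; apply: eq_bigr => u _ /=.
rewrite [RHS](reindex_inj (mulgI u)); apply: eq_bigr => t _ /=.
by rewrite rmorphM mulrA mulKg /= -actQ_mul invMg mulgA.
Qed.

Fact twmul1 : left_id (delta 1%g) twmul.
Proof.
move=> x; apply/ffunP => w; rewrite twmulE (bigD1 1%g) //= big1 ?addr0 => [|v v1].
  by rewrite deltaE eqxx mul1r actQ1 invg1 mul1g.
by rewrite deltaE (negPf v1) mul0r.
Qed.

Fact twmulr1 : right_id (delta 1%g) twmul.
Proof.
move=> x; apply/ffunP => w; rewrite twmulE (bigD1 w) //= big1 ?addr0 => [|v vw].
  by rewrite deltaE mulVg eqxx rmorph1 mulr1.
by rewrite deltaE -eq_mulVg1 (negPf vw) rmorph0 mulr0.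
Qed.

Fact twmulDl : left_distributive twmul +%R.
Proof.
move=> x y z; apply/ffunP => w; rewrite twaddE !twmulE -big_split /=.
by apply: eq_bigr => v _; rewrite twaddE mulrDl.
Qed.

Fact twmulDr : right_distributive twmul +%R.
Proof.
move=> x y z; apply/ffunP => w; rewrite twaddE !twmulE -big_split /=.
by apply: eq_bigr => v _; rewrite twaddE rmorphD mulrDr.
Qed.

Fact delta1_neq0 : delta 1%g != 0.
Proof. by apply/eqP => /ffunP /(_ 1%g) /eqP; rewrite deltaE ffunE eqxx oner_eq0. Qed.

HB.instance Definition _ := GRing.Zmodule_isNzRing.Build twisted
  twmulA twmul1 twmulr1 twmulDl twmulDr delta1_neq0.

Lemma tw1E : 1 = delta 1%g. Proof. by []. Qed.
Lemma twM x y : x * y = twmul x y. Proof. by []. Qed.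

Fact twscaleAl (a : Q) (x y : twisted) : a *: (x * y) = a *: x * y.
Proof.
apply/ffunP => w; rewrite twscaleE !twM !twmulE mulr_sumr.
by apply: eq_bigr => v _; rewrite twscaleE mulrA.
Qed.
HB.instance Definition _ := GRing.Lmodule_isLalgebra.Build Q twisted twscaleAl.

Lemma delta_mul p w p' w' :
  (p *: delta w) * (p' *: delta w') = (p * actQ w p') *: delta (w * w')%g.
Proof.
apply/ffunP => v; rewrite twM twmulE twscaleE (bigD1 w) //= big1 ?addr0; last first.
  by move=> u uw; rewrite twscaleE deltaE (negPf uw) mulr0 mul0r.
rewrite !twscaleE !deltaE eqxx mulr1 rmorphM /= rmorph_nat mulrA.
by rewrite (can2_eq (mulKVg w) (mulKg w)).
Qed.

Definition twunit : pred twisted := fun x => `[< exists y, y * x = 1 /\ x * y = 1 >].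
Definition twinv (x : twisted) : twisted :=
  if pselect (exists y, y * x = 1 /\ x * y = 1) is left H then projT1 (cid H) else x.
Fact twmulVx : {in twunit, left_inverse 1 twinv *%R}.
Proof.
by move=> x /asboolP H; rewrite /twinv; case: pselect => // H'; case: (projT2 (cid H')).
Qed.
Fact twmulxV : {in twunit, right_inverse 1 twinv *%R}.
Proof.
by move=> x /asboolP H; rewrite /twinv; case: pselect => // H'; case: (projT2 (cid H')).
Qed.
Fact twunitP x y : y * x = 1 /\ x * y = 1 -> twunit x.
Proof. by move=> e; apply/asboolP; exists y. Qed.
Fact twinv_out : {in [predC twunit], twinv =1 id}.
Proof. by move=> x /asboolP H; rewrite /twinv; case: pselect. Qed.
HB.instance Definition _ := GRing.NzRing_hasMulInverse.Build twisted
  twmulVx twmulxV twunitP twinv_out.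

Definition tw_act (z : twisted) (p : Q) : Q := \sum_w z w * actQ w p.

Lemma tw_actM z z' p : tw_act (z * z') p = tw_act z (tw_act z' p).
Proof.
rewrite /tw_act; under eq_bigr do rewrite twM twmulE mulr_suml.
rewrite exchange_big; apply: eq_bigr => v _ /=.
rewrite rmorph_sum mulr_sumr (reindex_inj (mulgI v)); apply: eq_bigr => w _ /=.
by rewrite mulKg rmorphM /= -actQ_mul mulrA.
Qed.

Definition twisted_dual := 'Hom(twisted, Q^o).

Definition fdual (w : W) : twisted_dual := linfun (fun z : twisted => z w : Q^o).
Definition bullet (z : twisted) (f : twisted_dual) : twisted_dual := linfun (fun z' : twisted => f (z' * z)).
Definition dual_mul (f g : twisted_dual) : twisted_dual :=
  \sum_w ((f (delta w) : Q) * g (delta w)) *: fdual w.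

Fact fdual_linear w : linear (fun z : twisted => z w : Q^o).
Proof. by move=> a x y; rewrite !ffunE. Qed.
Fact bullet_linear z (f : twisted_dual) : linear (fun z' : twisted => f (z' * z)).
Proof. by move=> a x y; rewrite mulrDl -scalerAl linearP. Qed.

Lemma fdualE w z : fdual w z = z w.
Proof.
pose L := GRing.isLinear.Build _ _ _ _ _ (fdual_linear w).
pose F : {linear twisted -> Q^o} := HB.pack (fun z : twisted => z w : Q^o) L.
exact: (lfunE F).
Qed.
Lemma bulletE z f z' : bullet z f z' = f (z' * z).
Proof.
pose L := GRing.isLinear.Build _ _ _ _ _ (bullet_linear z f).
pose F : {linear twisted -> Q^o} := HB.pack (fun z' : twisted => f (z' * z)) L.
exact: (lfunE F).
Qed.

Lemma dual_mulE f g w : dual_mul f g (delta w) = (f (delta w) : Q) * g (delta w).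
Proof.
rewrite sum_lfunE (bigD1 w) //= big1 ?addr0 => [|v vw].
  by rewrite scale_lfunE fdualE deltaE eqxx [_ *: _]mulr1.
by rewrite scale_lfunE fdualE deltaE (negPf vw) scaler0.
Qed.
End TwistedRing.

Section StableBasis.
Context (D : root_datum).
Local Notation W := (weyl D).
Local Notation n := (nsimple D).
Local Notation Q := (Qm D).
Local Notation q := (q D).
Local Notation qh := (qh D).
Local Notation eQ := (@eQ D).

Definition hatx (w : W) : Q :=
  \prod_(a | posroot a && positive_vec (- (weyl_mx w^-1%g *m root a)))
    (1 - q * eQ (- root a)).

Definition tau (i : 'I_n) : twisted D :=
  let a := root (simple i) in
  ((q - 1) / (1 - eQ a)) *: 1
  + ((1 - q * eQ (- a)) / (1 - eQ a)) *: delta (srefl i).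

Definition tau_seq (I : seq 'I_n) : twisted D := \prod_(i <- I) tau i.

Definition tau_weyl (w : W) : twisted D := tau_seq (redword w).

Definition stab (w : W) : twisted_dual D :=
  (q ^+ len (w0 D) * qh ^- len w) *:
    bullet (tau_weyl (w0 D * w)%g)^-1
      ((\prod_(a | posroot a) (1 - eQ (root a))) *: fdual (w0 D)).

Definition subword (I : seq 'I_n) (E : {set 'I_(size I)}) : seq 'I_n :=
  [seq tnth (in_tuple I) j | j <- enum E].

Definition Bfactor (I : seq 'I_n) (E F : {set 'I_(size I)}) (j : 'I_(size I)) :
    twisted D :=
  let i := tnth (in_tuple I) j in let a := root (simple i) in
  if (j \in E) && (j \in F) then
    ((1 - eQ a) / (1 - q * eQ (- a))) *: delta (srefl i)
  else if (j \in E) || (j \in F) then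
    ((1 - q) / (1 - q * eQ (- a))) *: delta (srefl i)
  else
    ((q - 1) / (1 - q * eQ (- a))) *: (tau i * delta (srefl i)).

Definition Pcoef (I : seq 'I_n) (E F : {set 'I_(size I)}) : Q :=
  tw_act (\prod_(j < size I) Bfactor E F j) 1.

End StableBasis.

(* Main.v *)
From mathcomp Require Import all_boot all_order all_algebra all_fingroup.
From mathcomp Require Import cyclic boolp monalg.
From mathcomp Require Import ring.
Require Import Defs.

Set Implicit Arguments.
Unset Strict Implicit.
Unset Printing Implicit Defensive.

Import Order.TTheory GRing.Theory Num.Theory.
Local Open Scope ring_scope.

(** The stable basis is dual, up to scalars, to the basis [tau_weyl] of the
    twisted group algebra: [stab u] takes the value [qh ^+ len u * hatx w0] at
    [tau_weyl u] and vanishes at the other [tau_weyl w] ([stab_tau_weyl]). Hence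
    the coefficient of [stab w] in a product is, up to scalars, the value of this
    product at [tau_weyl w]. Now the product of linear forms is dual to the
    coproduct [delta w |-> delta w (x) delta w]. Writing [delta] through [tau],
    the coproduct of one [tau i] is a combination of [tau (x) tau],
    [tau (x) 1], [1 (x) tau] and [1 (x) 1], and its coefficients are the operators
    [Bfactor]; along a word [I] they multiply to a sum over pairs of subwords
    with coefficients [Pcoef E F] ([diagonal_tau_seq]). Finally [stab u] takes at
    [tau_seq] of a subword the value [c (subword E) u], up to the scalar above.

    The duality comes from the symmetrizing trace of the Hecke algebra. As
    [tau w * (tau w0)^-1] is the inverse of [tau (w0 * w^-1)], and the inverse of
    a word in the [tau]'s only involves group elements that are no longer than the
    word, its coefficient of [delta w0] vanishes unless [w = 1]; so [z |-> (z * (tau w0)^-1) (w0)] is a multiple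
    of the trace, for which [tau u] and [tau v] are orthogonal unless
    [v = u^-1] ([trace_tau_seqM]).

    The Hecke algebra itself needs [tau_seq I] to depend only on [w] when [I] is a
    reduced word of [w]. Let all [e^-a], with [a] simple, tend to 0. After
    transporting the coefficient of [delta x] to the chamber of [x] and
    normalizing it, [tau_seq I] degenerates to the basis vector [w]
    ([limit_tau_seq]). Structure coefficients in [Rm] are unaffected by the limit,
    so the expansion of [tau_seq I] reduces to [tau_weyl w] ([tau_reduced]).

    The summation ranges come from supports. A product [tau_seq I] is supported on
    the products of subwords of [I]; these only depend on the 0-Hecke class of
    [I], which contains a reduced word of [demazure I] by Matsumoto's theorem, and
    the subwords of a reduced word have products below it in the Bruhat order
    ([subproduct_demazure]). Since the passage between [delta] and [tau_weyl] is
    triangular, [stab u] vanishes at [delta x] unless [u] is below [x]. *)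

(** * Positive roots and inversions *)

Section Roots.
Context (D : root_datum).
Local Notation W := (weyl D).
Local Notation n := (nsimple D).
Implicit Types (a b : 'I_(nroots D)) (i j : 'I_n) (u v w x : W).

Lemma simple_indep (z : 'I_n -> int) :
  \sum_i root (simple i) *~ z i = 0 -> forall i, z i = 0.
Proof.
move=> z0 i; have := simple_free D; set A := (X in row_free X) => fA.
pose v : 'rV[rat]_n := \row_k (z k)%:~R.
suff /rowP/(_ i) : v = 0 by rewrite !mxE => /eqP; rewrite intr_eq0 => /eqP.
apply/eqP; rewrite -(mulmx_free_eq0 v fA); apply/eqP/rowP => l; rewrite !mxE.
have := congr1 (fun M : 'cV[int]_(rk D) => (M l 0)%:~R : rat) z0.
rewrite summxE mxE rmorph_sum /= => e; rewrite -[RHS]e; apply: eq_bigr => k _.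
by rewrite !mxE -scaler_int mxE intz rmorphM.
Qed.

Lemma positive_vecD (x y : 'cV[int]_(rk D)) :
  positive_vec x -> positive_vec y -> positive_vec (x + y).
Proof.
move=> /asboolP[c ->] /asboolP[d ->]; apply/asboolP; exists (fun i => (c i + d i)%N).
by rewrite -big_split; apply: eq_bigr => i _; rewrite mulrnDr.
Qed.

Lemma positive_vec0 : positive_vec (0 : 'cV[int]_(rk D)).
Proof. by apply/asboolP; exists (fun=> 0%N); rewrite big1. Qed.

Lemma positive_vec_antisym (x : 'cV[int]_(rk D)) :
  positive_vec x -> positive_vec (- x) -> x = 0.
Proof.
move=> /asboolP[c xc] /asboolP[d xd].
have H i : ((c i + d i)%N : int) = 0.
  apply: (@simple_indep (fun i => Posz (c i + d i)%N)).
  rewrite -[RHS](addrN x) [in RHS]xd [in RHS]xc -big_split /=.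
  by apply: eq_bigr => k _; rewrite -pmulrn mulrnDr.
rewrite xc big1 // => i _; have /eqP := H i.
by rewrite eqz_nat addn_eq0 => /andP[/eqP -> _].
Qed.

Lemma root_neq0 a : root a != 0.
Proof. by apply: contra_eqN (coroot_root a) => /eqP ->; rewrite mulmx0 mxE. Qed.

Lemma posrootN a : ~~ posroot a = positive_vec (- root a).
Proof.
apply/idP/idP => [|H]; last first.
  by apply: contra (root_neq0 a) => /positive_vec_antisym -> //.
have [c [e|e]] := simple_base a; first by case/negP; apply/asboolP; exists c.
by move=> _; apply/asboolP; exists c; rewrite e opprK.
Qed.

Lemma posroot_simple i : posroot (simple i).
Proof.
apply/asboolP; exists (fun j => (j == i) : nat); rewrite (bigD1 i) //= eqxx big1 ?addr0 //.
by move=> j /negPf ->.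
Qed.

Lemma root_opp_ex a : exists b, root b == - root a.
Proof.
have [b e] := root_refl a a; exists b; apply/eqP.
by rewrite e coroot_root [2%:~R *: _]scaler_nat mulr2n opprD addNKr.
Qed.

Definition ropp a : 'I_(nroots D) := xchoose (root_opp_ex a).

Lemma root_ropp a : root (ropp a) = - root a.
Proof. exact/eqP/(xchooseP (root_opp_ex a)). Qed.

Lemma posroot_ropp a : posroot (ropp a) = ~~ posroot a.
Proof. by rewrite posrootN -root_ropp. Qed.

Lemma len_max w : (len w <= len (w0 D))%N.
Proof. by rewrite /w0; case: arg_maxnP => // v _; apply. Qed.

(* Unification must not unfold these into enumerations of the roots or of the
   Weyl group. *)
Local Opaque weyl_perm ropp w0 weyl_inv.
Local Notation "w ** a" := (weyl_perm w a) (at level 38, right associativity).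

Lemma roppK : involutive ropp.
Proof. by move=> a; apply: root_inj; rewrite !root_ropp opprK. Qed.
Lemma weyl_permM u v a : (u * v)%g ** a = u ** v ** a.
Proof. by apply: root_inj; rewrite !weyl_permE mulmxA. Qed.
Lemma weyl_perm1 a : 1%g ** a = a.
Proof. by apply: root_inj; rewrite !weyl_permE mul1mx. Qed.
Lemma weyl_permK w a : w^-1%g ** w ** a = a.
Proof. by rewrite -weyl_permM mulVg weyl_perm1. Qed.
Lemma weyl_permKV w a : w ** w^-1%g ** a = a.
Proof. by rewrite -weyl_permM mulgV weyl_perm1. Qed.
Lemma weyl_perm_injr w : injective (weyl_perm w).
Proof. exact: can_inj (weyl_permK w). Qed.
Lemma weyl_perm_ropp w a : w ** ropp a = ropp (w ** a).
Proof. by apply: root_inj; rewrite root_ropp !weyl_permE root_ropp mulmxN. Qed.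

Lemma srefl2 i : (srefl i * srefl i = 1)%g.
Proof. by apply: val_inj; rewrite /= refl_mx2. Qed.
Lemma sreflV i : (srefl i)^-1%g = srefl i.
Proof. by apply: (mulgI (srefl i)); rewrite mulgV srefl2. Qed.
Lemma sreflK i w : (srefl i * (srefl i * w))%g = w.
Proof. by rewrite mulgA srefl2 mul1g. Qed.

Lemma srefl_simple i : srefl i ** simple i = ropp (simple i).
Proof.
apply: root_inj; rewrite weyl_permE root_ropp /= refl_mxE coroot_root.
by rewrite [2%:~R *: _]scaler_nat mulr2n opprD addNKr.
Qed.

(** A positive multiple of a simple root that is a root is that simple root:
    pairing with the coroot shows that the multiplicity divides 2. *)
Lemma root_multiple a i (c : nat) : root a = root (simple i) *+ c -> a = simple i.
Proof.
move=> e; apply: root_inj; rewrite e; suff -> : c = 1%N by [].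
have := coroot_root a; rewrite e -scaler_nat -scalemxAr mxE.
set z := (_ *m _) _ _ => cz.
have dv : (c %| 2)%N.
  by rewrite -[(c %| 2)%N]/(`|c%:Z| %| `|2%:Z|)%N; apply/dvdzP; exists z; rewrite mulrC; move: cz; rewrite natz => ->.
have c0 : c != 0%N by apply: contra_eqN e => /eqP ->; exact: root_neq0.
have : (c <= 2)%N by exact: dvdn_leq dv.
case: c e {cz dv} c0 => [|[|[|c]]] //= e _ _.
by case: (root_reduced e).
Qed.

(** A positive root other than [simple i] involves some simple root different
    from [simple i], and the reflection leaves that coefficient unchanged. *)
Lemma srefl_posroot i a : posroot a -> a != simple i -> posroot (srefl i ** a).
Proof.
move=> /asboolP[c ac] ai.
have [j ji cj] : exists2 j, j != i & c j != 0%N.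
  apply: contrapT => H; case/eqP: ai; apply: (@root_multiple _ _ (c i)).
  rewrite ac (bigD1 i) //= big1 ?addr0 // => j ji.
  by case: (c j =P 0%N) => [->//|/eqP cj]; case: H; exists j.
apply/negP => /negP; rewrite posrootN => /asboolP[d]; rewrite weyl_permE /= refl_mxE.
set m := (_ *m _) _ _ => /eqP; rewrite -subr_eq0 ac => /eqP e.
have := @simple_indep (fun k => (c k)%:Z - m *+ (k == i) + (d k)%:Z) _ j.
rewrite (negPf ji) mulr0n subr0 -PoszD => H; have {}H : (c j + d j)%N = 0%N.
  apply/eqP; rewrite -eqz_nat; apply/eqP/H; apply: oppr_inj; rewrite oppr0 -[RHS]e opprB addrC.
  rewrite -[m *: _](_ : \sum_k root (simple k) *~ (m *+ (k == i)) = _); last first.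
    rewrite (bigD1 i) //= eqxx big1 ?addr0 => [|k /negPf ->//].
    by rewrite mulr1n -scaler_int intz.
  rewrite -!sumrN -!big_split /=; apply: eq_bigr => k _.
  by rewrite mulrzDr mulrzBr -!pmulrn opprD opprB addrC.
by move/eqP: H cj; rewrite addn_eq0 => /andP[/eqP ->].
Qed.

Definition inversions w := [set a | posroot a && ~~ posroot (w^-1%g ** a)].

Lemma srefl_posroot_eq i a : a != simple i -> a != ropp (simple i) ->
  posroot (srefl i ** a) = posroot a.
Proof.
move=> ai aNi; apply/idP/idP => [H|H]; last exact: srefl_posroot.
rewrite -[a](weyl_permK (srefl i)) sreflV; apply: srefl_posroot => //.
by apply: contra aNi => /eqP e; rewrite -srefl_simple -e -weyl_permM srefl2 weyl_perm1.
Qed.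

Lemma inversions_srefl i w : posroot (w^-1%g ** simple i) ->
  inversions (srefl i * w)%g = simple i |: [set srefl i ** a | a in inversions w].
Proof.
move=> wi; apply/setP => a; rewrite !inE invMg sreflV weyl_permM.
case: (eqVneq a (simple i)) => [->|ai] /=.
  by rewrite posroot_simple srefl_simple weyl_perm_ropp posroot_ropp negbK wi.
rewrite -[a in RHS](weyl_permKV (srefl i) a) (mem_imset _ _ (@weyl_perm_injr _)).
rewrite inE sreflV; case pa: (posroot a); first by rewrite srefl_posroot.
apply/esym/negP => /andP[psa]; case: (eqVneq a (ropp (simple i))) => [->|aNi].
  by rewrite -srefl_simple -(weyl_permM (srefl i)) srefl2 weyl_perm1 wi.
by rewrite srefl_posroot_eq // pa in psa.
Qed.

Lemma simple_notin_inversions i w : simple i \notin [set srefl i ** a | a in inversions w].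
Proof.
apply/imsetP => -[a]; rewrite inE => /andP[pa _] e.
have := pa; rewrite -(weyl_permK (srefl i) a) -e sreflV srefl_simple.
by rewrite posroot_ropp posroot_simple.
Qed.

Lemma inversions1 : inversions 1%g = set0.
Proof. by apply/setP => a; rewrite !inE invg1 weyl_perm1 andbN. Qed.

Lemma card_inversions_srefl i w : posroot (w^-1%g ** simple i) ->
  #|inversions (srefl i * w)%g| = #|inversions w|.+1.
Proof.
by move/inversions_srefl ->; rewrite cardsU1 simple_notin_inversions card_imset //; exact: weyl_perm_injr.
Qed.

Lemma posroot_srefl i w :
  posroot ((srefl i * w)^-1%g ** simple i) = ~~ posroot (w^-1%g ** simple i).
Proof. by rewrite invMg sreflV weyl_permM srefl_simple weyl_perm_ropp posroot_ropp. Qed.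

Lemma word_prod_cons i I : word_prod (i :: I) = (srefl i * word_prod I)%g.
Proof. exact: big_cons. Qed.
Lemma word_prod_nil : word_prod [::] = 1%g :> W.
Proof. exact: big_nil. Qed.
Lemma word_prod_cat I J : word_prod (I ++ J) = (word_prod I * word_prod J)%g :> W.
Proof. exact: big_cat. Qed.

(** * Reflections and the exchange condition *)

Lemma pairD (c : 'rV[int]_(rk D)) (x y : 'cV[int]_(rk D)) s :
  (c *m (x + s *: y)) 0 0 = (c *m x) 0 0 + s * (c *m y) 0 0.
Proof. by rewrite mulmxDr -scalemxAr mxE; congr (_ + _); rewrite mxE. Qed.

(** A coroot is determined by its root: the product of two reflections in the
    same root translates every root by multiples of that root, which is
    impossible for a finite spanning set of roots. *)
Lemma coroot_uniq a (c : 'rV[int]_(rk D)) : (c *m root a) 0 0 = 2 ->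
  (forall b, exists b', root b' = root b - (c *m root b) 0 0 *: root a) ->
  c = coroot a.
Proof.
move=> ca cr; pose d b := (coroot a *m root b) 0 0 - (c *m root b) 0 0.
have shift b k : exists b', root b' == root b + (d b *+ k) *: root a.
  elim: k => [|k [b1 /eqP e1]]; first by exists b; rewrite mulr0n scale0r addr0.
  have [b2 e2] := root_refl a b1; have [b3 e3] := cr b2; exists b3.
  move: e3; rewrite e2 e1 -!scaleNr !pairD ca coroot_root => ->.
  by rewrite -!addrA -!scalerDl /d mulrS; apply/eqP; congr (_ + _ *: _); ring.
have d0 b : d b = 0.
  apply: contrapT => /eqP db; pose f (k : 'I_(nroots D).+1) := xchoose (shift b k).
  have f_inj : injective f.
    move=> k l kl; apply/val_inj/eqP => /=.
    have := eqP (xchooseP (shift b k)); rewrite -/(f k) kl (eqP (xchooseP (shift b l))).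
    move/(congr1 (fun v : 'cV[int]_(rk D) => (coroot a *m v) 0 0)).
    rewrite !pairD coroot_root => /addrI/(mulIf (isT : 2 != 0 :> int))/eqP.
    by rewrite -mulr_natr -[_ *+ k]mulr_natr (inj_eq (mulfI db)) eqr_nat eq_sym.
  by have := leq_card f f_inj; rewrite !card_ord ltnn.
have /row_fullP[B BA] := root_semisimple D; set A := (X in B *m X) in BA.
apply/esym/eqP; rewrite -subr_eq0; apply/eqP; pose m := map_mx (intr : int -> rat).
suff : (m _ _ (coroot a - c))^T = 0.
  move/matrixP => H; apply/matrixP => i j; have := H j i; rewrite !mxE => /eqP.
  by rewrite intr_eq0 => /eqP.
rewrite -[LHS]mul1mx -BA -mulmxA (_ : A *m _ = 0) ?mulmx0 //.
apply/row_matrixP => b; rewrite row_mul rowK row0 /m !map_trmx -map_mxM -trmx_mul.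
rewrite [_ *m _]mx11_scalar (_ : _ 0 0 = 0) ?raddf0 ?map_mx0 ?trmx0 //.
by have := d0 b; rewrite /d => e; rewrite -[RHS]e mulmxBl mxE; congr (_ + _); rewrite mxE.
Qed.

Lemma refl_mx_ropp a : refl_mx (ropp a) = refl_mx a.
Proof.
suff e : - coroot (ropp a) = coroot a.
  by rewrite /refl_mx root_ropp -e mulNmx mulmxN.
apply: coroot_uniq => [|b].
  by rewrite -[root a]opprK -root_ropp mulmxN mulNmx opprK coroot_root.
have [b' e] := root_refl (ropp a) b; exists b'; rewrite e root_ropp scalerN mulNmx.
by rewrite [in RHS]mxE scaleNr opprK.
Qed.

Lemma refl_mx_conj w b :
  refl_mx (w ** b) = weyl_mx w *m refl_mx b *m weyl_mx w^-1%g.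
Proof.
have VK : weyl_mx w^-1%g *m weyl_mx w = 1%:M by rewrite -[LHS]/(weyl_mx (w^-1 * w)%g) mulVg.
have KV : weyl_mx w *m weyl_mx w^-1%g = 1%:M by rewrite -[LHS]/(weyl_mx (w * w^-1)%g) mulgV.
suff e : coroot b *m weyl_mx w^-1%g = coroot (w ** b).
  by rewrite /refl_mx -e mulmxBr mulmxBl mulmx1 KV weyl_permE !mulmxA.
apply: coroot_uniq => [|b1].
  by rewrite weyl_permE mulmxA -(mulmxA _ _ (weyl_mx w)) VK mulmx1 coroot_root.
have [b' e] := root_refl b (w^-1%g ** b1); exists (w ** b').
by rewrite !weyl_permE e weyl_permE mulmxBr -scalemxAr !mulmxA KV mul1mx.
Qed.

(** A positive root that the inverse of a word makes negative is simple just
    before the letter that changes its sign. *)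
Lemma exchange_root I a : posroot a -> ~~ posroot ((word_prod I)^-1%g ** a) ->
  exists K1 j K2, I = K1 ++ j :: K2 /\ a = word_prod K1 ** simple j.
Proof.
elim: I a => [|i I IH] a pa; first by rewrite word_prod_nil invg1 weyl_perm1 pa.
rewrite word_prod_cons invMg sreflV weyl_permM => Na.
case: (eqVneq a (simple i)) => [->|ai].
  by exists [::], i, I; rewrite word_prod_nil weyl_perm1.
have [||K1 [j [K2 [-> e]]]] := IH (srefl i ** a) => //; first exact: srefl_posroot.
exists (i :: K1), j, K2; split=> //.
by rewrite word_prod_cons weyl_permM -e -weyl_permM srefl2 weyl_perm1.
Qed.

(** The reflection in the root of [exchange_root] is conjugate to the simple
    reflection of the letter found there, which it therefore cancels. *)
Lemma exchange I a (t : W) : weyl_mx t = refl_mx a -> posroot a ->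
    ~~ posroot ((word_prod I)^-1%g ** a) ->
  exists K1 j K2, [/\ I = K1 ++ j :: K2, (t * word_prod I)%g = word_prod (K1 ++ K2)
    & (t * word_prod K1)%g = word_prod (rcons K1 j)].
Proof.
move=> ta pa /(exchange_root pa)[K1 [j [K2 [-> e]]]]; exists K1, j, K2.
have -> : t = (word_prod K1 * srefl j * (word_prod K1)^-1)%g.
  by apply: val_inj; rewrite /= ta e refl_mx_conj.
split=> //; last by rewrite -cats1 word_prod_cat word_prod_cons word_prod_nil mulg1 mulgKV.
by rewrite !word_prod_cat word_prod_cons mulgA mulgKV -mulgA sreflK.
Qed.

Lemma len_le_word I : (len (word_prod I : W) <= size I)%N.
Proof.
rewrite /len; case: ex_minnP => m _; apply; apply/existsP.
by exists (in_tuple I); apply/eqP.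
Qed.

Lemma reduced_word_exists w : exists2 I, word_prod I = w & size I = len w.
Proof. by have /andP[/eqP e /eqP s] := redwordP w; exists (redword w). Qed.

(** Were the first letter of a reduced word to remove an inversion, exchanging it
    would shorten the word. *)
Lemma size_reduced I : size I = len (word_prod I) -> #|inversions (word_prod I)| = size I.
Proof.
elim: I => [|i I IH] sI; first by rewrite word_prod_nil inversions1 cards0.
have rI : size I = len (word_prod I).
  apply/eqP; rewrite eqn_leq len_le_word andbT leqNgt; apply/negP => lt.
  have [K Kw sK] := reduced_word_exists (word_prod I).
  have := len_le_word (i :: K); rewrite word_prod_cons Kw -word_prod_cons -sI /= sK.
  by rewrite ltnNge lt.
rewrite word_prod_cons /= -IH //.
case pi: (posroot ((word_prod I)^-1%g ** simple i)); first by rewrite card_inversions_srefl.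
have [//||K1 [j [K2 [eI e _]]]] := @exchange I (simple i) (srefl i) _ (posroot_simple i).
  by rewrite pi.
have := len_le_word (K1 ++ K2); rewrite -e -word_prod_cons -sI eI /= !size_cat /=.
by rewrite addnS ltnNge leqnSn.
Qed.

Lemma len_inversions w : len w = #|inversions w|.
Proof. by have [I <- sI] := reduced_word_exists w; rewrite size_reduced. Qed.

(** * Length and Bruhat order *)

Lemma len1 : len (1%g : W) = 0%N.
Proof. by rewrite len_inversions inversions1 cards0. Qed.

Lemma len_srefl i w :
  len (srefl i * w)%g = if posroot (w^-1%g ** simple i) then (len w).+1 else (len w).-1.
Proof.
rewrite !len_inversions; case pi: posroot; first by rewrite card_inversions_srefl.
have := @card_inversions_srefl i (srefl i * w)%g; rewrite posroot_srefl pi sreflK => /(_ isT) ->.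
by [].
Qed.

Lemma len_gt0 i w : ~~ posroot (w^-1%g ** simple i) -> (0 < len w)%N.
Proof.
move=> pi; rewrite len_inversions; have := @card_inversions_srefl i (srefl i * w)%g.
by rewrite posroot_srefl pi sreflK => /(_ isT) ->.
Qed.

Lemma descentE i w : (len (srefl i * w)%g < len w)%N = ~~ posroot (w^-1%g ** simple i).
Proof.
rewrite len_srefl; case pi: posroot; first by rewrite ltnNge leqnSn.
by have := @len_gt0 i w; rewrite pi => /(_ isT); rewrite ltn_predL.
Qed.

Lemma ascentE i w : (len w < len (srefl i * w)%g)%N = posroot (w^-1%g ** simple i).
Proof.
rewrite len_srefl; case pi: posroot; first by rewrite ltnSn.
by rewrite ltnNge leq_pred.
Qed.

Lemma len_ascent i w : posroot (w^-1%g ** simple i) -> len (srefl i * w)%g = (len w).+1.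
Proof. by rewrite len_srefl => ->. Qed.

Lemma len_descent i w : ~~ posroot (w^-1%g ** simple i) -> len w = (len (srefl i * w)%g).+1.
Proof. by move=> pi; rewrite -(@len_ascent i) ?sreflK // posroot_srefl. Qed.

(** One direction is the deletion of a letter; the other one is the same
    statement for [t * x], as [t] negates [a]. *)
Lemma len_reflection a (t : W) x : weyl_mx t = refl_mx a -> posroot a ->
  (len x < len (t * x)%g)%N = posroot (x^-1%g ** a).
Proof.
move=> ta pa.
have down y : ~~ posroot (y^-1%g ** a) -> (len (t * y)%g < len y)%N.
  move=> py; have [I e sI] := reduced_word_exists y; move: py; rewrite -e.
  case/(exchange ta pa) => K1 [j [K2 [eI -> _]]]; rewrite e -sI eI.
  by rewrite (leq_ltn_trans (len_le_word _)) // !size_cat /= addnS.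
case px: (posroot _); last by rewrite ltnNge ltnW // down // px.
have t2 : (t * t)%g = 1%g by apply: val_inj; rewrite /= ta refl_mx2.
have tV : (t^-1)%g = t by apply: (mulgI t); rewrite mulgV t2.
have ra : t ** a = ropp a.
  apply: root_inj; rewrite weyl_permE root_ropp ta refl_mxE coroot_root.
  by rewrite [2%:~R *: _]scaler_nat mulr2n opprD addNKr.
have := down (t * x)%g; rewrite mulgA t2 mul1g; apply.
by rewrite invMg tV weyl_permM ra weyl_perm_ropp posroot_ropp px.
Qed.

Lemma is_reflP (t : W) : is_refl t -> exists2 a, weyl_mx t = refl_mx a & posroot a.
Proof.
case/existsP=> a /eqP ta; case pa: (posroot a); first by exists a.
by exists (ropp a); rewrite ?refl_mx_ropp // posroot_ropp pa.
Qed.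

Lemma is_refl_srefl i : is_refl (srefl i).
Proof. by apply/existsP; exists (simple i). Qed.

Lemma bruhat_refl w : bruhat w w. Proof. exact: connect0. Qed.
Lemma bruhat_trans : transitive (@bruhat D). Proof. exact: connect_trans. Qed.

Lemma bruhat_len u w : bruhat u w -> u = w \/ (len u < len w)%N.
Proof.
case/connectP=> p; elim: p u => [|v p IH] u /=; first by move=> _ ->; left.
case/andP=> /andP[uv _] pv ew; right.
case: (IH v pv ew) => [e|vw]; first by rewrite -e.
exact: ltn_trans uv vw.
Qed.

Lemma bruhat_ascent i w : posroot (w^-1%g ** simple i) -> bruhat w (srefl i * w)%g.
Proof.
move=> pi; apply/connect1/andP; rewrite ascentE pi; split=> //.
by apply/existsP; exists (srefl i); rewrite is_refl_srefl eqxx.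
Qed.

(** Unless the step [v = t * u] is multiplication by [srefl i] itself, the
    conjugate reflection is again in a positive root, so that the step survives
    left multiplication by [srefl i]. *)
Lemma bruhat_srefl i u w : bruhat u w ->
  bruhat (srefl i * u)%g w \/ bruhat (srefl i * u)%g (srefl i * w)%g.
Proof.
case/connectP=> p; elim: p u => [|v p IH] u /=.
  by move=> _ ->; right; exact: bruhat_refl.
case/andP=> /andP[uv /existsP[t /andP[/is_reflP[a ta pa] /eqP ev]]] pv ew.
have vw : bruhat v w by apply/connectP; exists p.
have pu : posroot (u^-1%g ** a) by rewrite -(len_reflection _ ta) -?ev.
case: (eqVneq a (simple i)) => [ai|ai].
  suff <- : v = (srefl i * u)%g by left.
  by rewrite ev; congr (_ * _)%g; apply: val_inj; rewrite /= ta ai.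
have siuv : bruhat (srefl i * u)%g (srefl i * v)%g.
  pose t' := (srefl i * t * (srefl i)^-1)%g.
  have tE : weyl_mx t' = refl_mx (srefl i ** a) by rewrite refl_mx_conj -ta.
  have e : (srefl i * v = t' * (srefl i * u))%g by rewrite ev !mulgA mulgKV.
  apply/connect1/andP; split.
    have psa : posroot (srefl i ** a) by exact: srefl_posroot.
    by rewrite e (len_reflection _ tE psa) invMg (weyl_permM u^-1%g) (weyl_permK (srefl i)).
  by rewrite e; apply/existsP; exists t'; rewrite eqxx andbT; apply/existsP; exists (srefl i ** a); rewrite tE.
by have [siv|siv] := IH v pv ew; [left|right]; apply: bruhat_trans siv.
Qed.

Lemma reduced_cons i I w : reduced_word (i :: I) w ->
  reduced_word I (srefl i * w)%g /\ ~~ posroot (w^-1%g ** simple i).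
Proof.
case/andP=> /eqP <- sI; set v := word_prod _.
have vE : (srefl i * v)%g = word_prod I by rewrite /v word_prod_cons sreflK.
have rI : reduced_word I (srefl i * v)%g.
  rewrite /reduced_word vE eqxx eqn_leq len_le_word andbT /=.
  rewrite -ltnS -[(size I).+1]/(size (i :: I)) (eqP sI) -/v -vE.
  by rewrite len_srefl; case: ifP => _; rewrite ?leqSpred // ltnW // ltnW.
split=> //; rewrite -descentE; case/andP: rI => _ /eqP <-.
by rewrite -(eqP sI).
Qed.

Lemma reduced_ascent i I w : reduced_word I w -> posroot (w^-1%g ** simple i) ->
  reduced_word (i :: I) (srefl i * w)%g.
Proof.
case/andP=> /eqP Iw sI pi.
by rewrite /reduced_word word_prod_cons Iw eqxx len_ascent //= (eqP sI).
Qed.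

Lemma bruhat_subseq w I K : reduced_word I w -> subseq K I -> bruhat (word_prod K) w.
Proof.
elim: I w K => [|i I IH] w K.
  by case/andP=> /eqP <- _; rewrite subseq0 => /eqP ->; exact: bruhat_refl.
move=> /reduced_cons[rI pi].
have up : bruhat (srefl i * w)%g w.
  by have := @bruhat_ascent i (srefl i * w)%g; rewrite sreflK; apply; rewrite posroot_srefl.
case: K => [|k K] /=; first by move=> _; apply: bruhat_trans up; apply: IH rI (sub0seq _).
case: eqP => [-> KI|_ KI]; last by apply: bruhat_trans up; apply: IH rI KI.
rewrite word_prod_cons; have := bruhat_srefl i (IH _ _ rI KI).
by rewrite sreflK => -[/bruhat_trans|//]; exact.
Qed.

(** * The longest element *)

(** An element of maximal length has no ascent, so its inverse makes every simple
    root negative. *)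
Lemma w0_negative a : posroot (w0 D ** a) = ~~ posroot a.
Proof.
have neg_simple i : ~~ posroot ((w0 D)^-1%g ** simple i).
  by rewrite -ascentE -leqNgt len_max.
have neg b : posroot b -> ~~ posroot ((w0 D)^-1%g ** b).
  move=> /asboolP[c bc]; rewrite posrootN weyl_permE bc mulmx_sumr -sumrN.
  elim/big_rec: _ => [|i x _]; [exact: positive_vec0 | apply: positive_vecD].
  rewrite (raddfMn (mulmx (weyl_mx _))) /= -mulNrn -weyl_permE; have := neg_simple i; rewrite posrootN.
  move=> pi; elim: (c i) => [|m IH]; first by rewrite mulr0n; exact: positive_vec0.
  by rewrite mulrS; exact: positive_vecD.
case pa: (posroot a).
  apply/negP => /neg; rewrite weyl_permK pa.
  by [].
by apply/negPn/negP; rewrite -posroot_ropp -weyl_perm_ropp => /neg; rewrite weyl_permK posroot_ropp pa.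
Qed.


Lemma posroot_w0V a : posroot ((w0 D)^-1%g ** a) = ~~ posroot a.
Proof. by rewrite -[a in RHS](weyl_permKV (w0 D)) w0_negative negbK. Qed.

Lemma len_eq1 w : len w = 0%N -> w = 1%g.
Proof.
by have [[|i I] <- <-] := reduced_word_exists w; rewrite ?word_prod_nil.
Qed.

Lemma inversions_w0 : inversions (w0 D) = [set a | posroot a].
Proof. by apply/setP => a; rewrite !inE posroot_w0V negbK andbb. Qed.

(** The inversions of [w0 * w] are the images under [- w0] of the positive
    roots that are not inversions of [w]. *)
Lemma len_w0M w : (len (w0 D * w)%g + len w)%N = len (w0 D).
Proof.
rewrite !len_inversions inversions_w0 -(cardsID (inversions w) [set a | posroot a]) addnC; congr (_ + _)%N.
  by apply: eq_card => a; rewrite !inE; case: posroot.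
pose f a := ropp (w0 D ** a).
have f_inj : injective f by move=> x y /(can_inj roppK); exact: weyl_perm_injr.
set B := _ :\: _; rewrite -[RHS](card_imset (mem B) f_inj); apply: eq_card => b.
have [a ->] : exists a, b = f a.
  by exists ((w0 D)^-1%g ** ropp b); rewrite /f weyl_permKV roppK.
have -> : (f a \in [set f x | x in B]) = (a \in B) by exact: mem_imset.
have e : (w0 D * w)^-1%g ** f a = ropp (w^-1%g ** a).
  rewrite (invMg (w0 D) w) (weyl_permM w^-1%g (w0 D)^-1%g) /f.
  by rewrite (weyl_perm_ropp (w0 D)^-1%g) (weyl_permK (w0 D) a) weyl_perm_ropp.
have e0 : posroot (f a) = posroot a by rewrite /f posroot_ropp w0_negative negbK.
rewrite [f a \in _]inE [a \in B]inE !inE e e0 posroot_ropp negbK.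
by case: (posroot a); rewrite //= negbK andbT.
Qed.

Lemma word_prod_rev I : word_prod (rev I) = (word_prod I)^-1%g :> W.
Proof.
elim: I => [|i I IH]; first by rewrite word_prod_nil invg1.
by rewrite rev_cons -cats1 word_prod_cat IH !word_prod_cons word_prod_nil mulg1 invMg sreflV.
Qed.

Lemma lenV w : len w^-1%g = len w.
Proof.
have le v : (len v^-1%g <= len v)%N.
  have [I <- <-] := reduced_word_exists v; rewrite -word_prod_rev.
  by rewrite (leq_trans (len_le_word _)) // size_rev.
by apply/eqP; rewrite eqn_leq le /= -[X in (len X <= _)%N]invgK le.
Qed.

Lemma len_eq_w0 w : len w = len (w0 D) -> w = w0 D.
Proof.
move=> lw; have e : (w0 D * w)%g = 1%g.
  by apply/len_eq1/eqP; rewrite -(eqn_add2r (len w)) len_w0M lw.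
have V : w = (w0 D)^-1%g by apply/(mulgI (w0 D)); rewrite e mulgV.
rewrite V; apply: (mulgI (w0 D)); rewrite mulgV; apply/esym/len_eq1/eqP.
by rewrite -(eqn_add2r (len (w0 D))) len_w0M.
Qed.

Lemma w0V : (w0 D)^-1%g = w0 D.
Proof. by apply: len_eq_w0; rewrite lenV. Qed.

End Roots.

(** * Reduced words and Demazure products *)

Section Words.
Context (D : root_datum).
Local Notation W := (weyl D).
Local Notation n := (nsimple D).
Implicit Types (a b : 'I_(nroots D)) (i j : 'I_n) (u v w x : W).
Local Opaque weyl_perm ropp w0 weyl_inv.
Local Notation "w ** a" := (weyl_perm w a) (at level 38, right associativity).

Lemma alternatingS i1 j1 m : alternating i1 j1 m.+1 = i1 :: alternating j1 i1 m :> seq 'I_n.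
Proof.
rewrite /alternating /=; congr (_ :: _); rewrite -[1%N]addn0 iotaDl -map_comp.
by apply: eq_map => k /=; case: odd.
Qed.

Lemma size_alternating i1 j1 m : size (alternating i1 j1 m : seq 'I_n) = m.
Proof. by rewrite size_map size_iota. Qed.

Lemma alternating_take i1 j1 k m : (k <= m)%N ->
  take k (alternating i1 j1 m : seq 'I_n) = alternating i1 j1 k.
Proof. by move=> km; rewrite /alternating -map_take take_iota (minn_idPl km). Qed.

Lemma word_prod_alternating i1 j1 d : word_prod (alternating i1 j1 d) =
  ((srefl i1 * srefl j1) ^+ d * word_prod (alternating j1 i1 d))%g :> W.
Proof.
elim: d i1 j1 => [|d IH] i1 j1; first by rewrite expg0 mul1g.
rewrite alternatingS word_prod_cons IH alternatingS word_prod_cons expgSr.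
rewrite -[(_ ^+ d * _ * _)%g]mulgA -[(srefl i1 * _ * _)%g]mulgA sreflK !mulgA; congr (_ * _)%g.
elim: d {IH} => [|d IH]; first by rewrite !expg0 mulg1 mul1g.
by rewrite expgSr mulgA IH expgSr !mulgA.
Qed.

Local Notation order i j := #[srefl i * srefl j]%g.

Lemma order_sym i j : order i j = order j i.
Proof. by rewrite -orderV invMg !sreflV. Qed.

Lemma word_prod_braid i j :
  word_prod (alternating i j (order i j)) = word_prod (alternating j i (order i j)) :> W.
Proof. by rewrite word_prod_alternating expg_order mul1g. Qed.

(** Exchanging [i] into a reduced word that starts with [k] alternating letters
    lengthens the alternating prefix: deleting one of the [k] letters would give
    a relation in the dihedral group shorter than its defining one. *)
Lemma reduced_alternating i j w k : ~~ posroot (w^-1%g ** simple i) ->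
    ~~ posroot (w^-1%g ** simple j) -> (k <= order i j)%N ->
  exists K, reduced_word (alternating i j k ++ K) w.
Proof.
elim: k i j => [|k IH] i j pi pj km.
  by have [I Iw sI] := reduced_word_exists w; exists I; rewrite /reduced_word Iw sI !eqxx.
have [K /andP[/eqP Kw sK]] := IH j i pj pi (ltnW (leq_trans km (eq_leq (order_sym i j)))).
have := exchange (I := alternating j i k ++ K) (erefl (weyl_mx (srefl i))) (posroot_simple i).
rewrite Kw => /(_ pi)[K1 [l [K2 [eK e1 e2]]]].
have kK1 : (k <= size K1)%N.
  rewrite leqNgt; apply/negP => K1k.
  have tk p : (p <= k)%N -> take p (K1 ++ l :: K2) = alternating j i p.
    by move=> pk; rewrite -eK take_cat size_alternating ltn_neqAle pk andbT;
      case: eqP => [->|_]; rewrite ?subnn ?take0 ?cats0 ?alternating_take.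
  have K1E : K1 = alternating j i (size K1) by rewrite -tk ?take_size_cat // ltnW.
  have K1lE : rcons K1 l = alternating j i (size K1).+1.
    by rewrite -tk // -cat_rcons take_size_cat ?size_rcons.
  move: e2; rewrite K1lE {1}K1E -word_prod_cons -alternatingS word_prod_alternating.
  rewrite -[RHS]mul1g => /mulIg/eqP; rewrite -order_dvdn => /dvdn_leq.
  by move=> /(_ isT); rewrite leqNgt (leq_ltn_trans K1k km).
pose K1' := drop k K1; have K1E : K1 = alternating j i k ++ K1'.
  rewrite -{1}(cat_take_drop k K1); congr (_ ++ _).
  by have := congr1 (take k) eK; rewrite take_size_cat ?size_alternating // takel_cat.
exists (K1' ++ K2); rewrite alternatingS /= catA -K1E /reduced_word word_prod_cons -e1 sreflK eqxx /=.
by rewrite -(eqP sK) eK !size_cat /= addnS.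
Qed.

Lemma hecke0_ctx K L I J : @hecke0_eq D I J -> hecke0_eq (K ++ I ++ L) (K ++ J ++ L).
Proof.
elim=> {I J} [I|I J _ /Hecke0_sym//|I J M _ h1 _ h2|I J i|I J i j]; first exact: Hecke0_refl.
- exact: Hecke0_trans h1 h2.
- by have := Hecke0_idem (K ++ I) (J ++ L) i; rewrite -!catA.
- by move=> m; have := Hecke0_braid (K ++ I) (J ++ L) i j; rewrite /= -!catA.
Qed.

Lemma hecke0_cons i I J : @hecke0_eq D I J -> hecke0_eq (i :: I) (i :: J).
Proof. by move/(hecke0_ctx [:: i] [::]); rewrite !cats0. Qed.

(** Matsumoto's theorem for the 0-Hecke relations. Two reduced words starting with
    distinct letters [i] and [j] are connected through the two reduced words that
    start with the braid word of [i] and [j]. *)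
Lemma matsumoto w I J : reduced_word I w -> reduced_word J w -> hecke0_eq I J.
Proof.
elim: {I}(size I) {-2}I (erefl (size I)) w J => [|k IH] I sI w J rI rJ.
  rewrite (size0nil sI) in rI *; case/andP: rI => _ sJ; case/andP: rJ => _.
  by rewrite -(eqP sJ) => /eqP/size0nil ->; exact: Hecke0_refl.
case: I sI rI => [|i I] //= [sI] rI; have [rI' pi] := reduced_cons rI.
have sIJ : size J = k.+1.
  by case/andP: rI => _ /eqP; case/andP: rJ => _ /eqP <- <-; rewrite /= sI.
case: J rJ sIJ => [|j J] //= rJ [sJ]; have [rJ' pj] := reduced_cons rJ.
case: (eqVneq i j) rJ' pj rJ => [<-|ij] rJ' pj rJ; first exact/hecke0_cons/(IH _ sI _ _ rI' rJ').
have [K rK] := reduced_alternating pi pj (leqnn _).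
have rK' : reduced_word (alternating j i (order i j) ++ K) w.
  case/andP: rK => /eqP <- /eqP sK; rewrite /reduced_word -sK !size_cat !size_alternating eqxx.
  by rewrite !word_prod_cat word_prod_braid eqxx.
have h : hecke0_eq (alternating i j (order i j) ++ K) (alternating j i (order i j) ++ K).
  exact: (Hecke0_braid [::] K i j).
move: rK rK' h.
case: (order i j) (order_gt0 (srefl i * srefl j)%g) => [|m] // _.
rewrite !alternatingS => /reduced_cons[rK _] /reduced_cons[rK' _] h.
apply: Hecke0_trans (hecke0_cons i (IH _ sI _ _ rI' rK)) _.
by apply: (Hecke0_trans h); apply/Hecke0_sym/hecke0_cons/(IH _ sJ _ _ rJ' rK').
Qed.

(** A letter that is a left descent is absorbed by idempotence, because the
    reduced word can be chosen to start with it. *)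
Lemma hecke0_reduced I : exists w J, reduced_word J w /\ @hecke0_eq D I J.
Proof.
elim: I => [|i I [w [J [rJ IJ]]]].
  by exists 1%g, [::]; split; [rewrite /reduced_word word_prod_nil len1 !eqxx | exact: Hecke0_refl].
case pi: (posroot (w^-1%g ** simple i)).
  by exists (srefl i * w)%g, (i :: J); split; [exact: reduced_ascent | exact: hecke0_cons].
have [K Kw sK] := reduced_word_exists (srefl i * w)%g.
have rK : reduced_word K (srefl i * w)%g by rewrite /reduced_word Kw sK !eqxx.
have riK : reduced_word (i :: K) w.
  by have := @reduced_ascent _ i K _ rK; rewrite sreflK; apply; rewrite posroot_srefl pi.
exists w, (i :: K); split=> //; apply: Hecke0_trans (hecke0_cons i IJ) _.
apply: Hecke0_trans (hecke0_cons i (matsumoto rJ riK)) _.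
exact: (Hecke0_idem [::] K i).
Qed.

Lemma demazure_reduced I : exists2 J, reduced_word J (demazure I) & @hecke0_eq D I J.
Proof.
rewrite /demazure; case: pickP => [w /asboolP //|H].
by have [w [J [rJ IJ]]] := hecke0_reduced I; have /asboolP[] := H w; exists J.
Qed.

(** Unlike the product of the whole word, this set of elements only depends on
    the 0-Hecke class of the word. *)
Definition subproduct I : W -> Prop := fun x => exists2 K, subseq K I & word_prod K = x.

Lemma subproduct_cat I J x : subproduct (I ++ J) x <->
  exists y z, [/\ subproduct I y, subproduct J z & x = (y * z)%g].
Proof.
split=> [[K /subseqP[m sm ->] <-]|[y [z [[K KI <-] [L LJ <-] ->]]]]; last first.
  by exists (K ++ L); [exact: cat_subseq | rewrite word_prod_cat].
exists (word_prod (mask (take (size I) m) I)), (word_prod (mask (drop (size I) m) J)); split.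
- by exists (mask (take (size I) m) I); first exact: mask_subseq.
- by exists (mask (drop (size I) m) J); first exact: mask_subseq.
rewrite -word_prod_cat -mask_cat ?cat_take_drop // size_takel // sm size_cat.
exact: leq_addr.
Qed.

Lemma subproduct_ctx I J K L :
  (forall x, subproduct I x -> subproduct J x) ->
  forall x, subproduct (K ++ I ++ L) x -> subproduct (K ++ J ++ L) x.
Proof.
move=> IJ x /subproduct_cat[y [z [Ky /subproduct_cat[z1 [z2 [Iz1 Lz2 ->]]] ->]]].
apply/subproduct_cat; exists y, (z1 * z2)%g; split=> //; apply/subproduct_cat.
by exists z1, z2; split=> //; exact: IJ.
Qed.

(** With [m] the order of [srefl i * srefl j], the alternating products of length
    at most [m] are closed under multiplication by [srefl i] and [srefl j]: they
    form the dihedral group generated by both reflections. *)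
Lemma dihedral_alternating i j K : all (mem [:: i; j]) K ->
  exists2 d, (d <= order i j)%N &
    word_prod K = word_prod (alternating i j d) \/ word_prod K = word_prod (alternating j i d).
Proof.
elim: K => [|k K IH] /=; first by exists 0%N => //; left.
case/andP=> kij /IH[d dm Kd]; rewrite word_prod_cons.
have step i1 j1 e : order i1 j1 = order i j -> (e <= order i j)%N ->
    exists2 d, (d <= order i j)%N &
      (srefl i1 * word_prod (alternating j1 i1 e) = word_prod (alternating i1 j1 d) \/
       srefl i1 * word_prod (alternating j1 i1 e) = word_prod (alternating j1 i1 d))%g.
  move=> o; rewrite leq_eqVlt => /orP[/eqP ->|em]; last first.
    by exists e.+1 => //; left; rewrite alternatingS word_prod_cons.
  case eo: (order i j) (order_gt0 (srefl i * srefl j)%g) => [|m] // _.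
  exists m => //; right; rewrite -{1}eo -o -word_prod_braid o eo.
  by rewrite alternatingS word_prod_cons sreflK.
have step' i1 j1 e : order i1 j1 = order i j -> (e <= order i j)%N ->
    exists2 d, (d <= order i j)%N &
      (srefl i1 * word_prod (alternating i1 j1 e) = word_prod (alternating i1 j1 d) \/
       srefl i1 * word_prod (alternating i1 j1 e) = word_prod (alternating j1 i1 d))%g.
  case: e => [|e] o em; first exact: step o em.
  by exists e; [exact: ltnW | right; rewrite alternatingS word_prod_cons sreflK].
rewrite !inE in kij; case/orP: kij => /eqP ->; case: Kd => ->.
- exact: step'.
- exact: step.
- by have [e em h] := step j i d (order_sym j i) dm; exists e => //; case: h; [right|left].
- by have [e em h] := step' j i d (order_sym j i) dm; exists e => //; case: h; [right|left].
Qed.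

Lemma subproduct_braid i j x : subproduct (alternating i j (order i j)) x ->
  subproduct (alternating j i (order i j)) x.
Proof.
case=> K Kij <-.
have [|d dm [|] ->] := @dihedral_alternating i j K.
- apply/allP => k /(mem_subseq Kij)/mapP[p _ ->]; rewrite !inE.
  by case: odd; rewrite eqxx ?orbT.
- case: (eqVneq d (order i j)) => [->|dm'].
    by rewrite word_prod_braid; exists (alternating j i (order i j)).
  exists (alternating i j d) => //.
  have: (d < order i j)%N by rewrite ltn_neqAle dm' dm.
  case: (order i j) => // m dm1; rewrite alternatingS -(alternating_take i j (dm1 : (d <= m)%N)).
  by apply: subseq_trans (take_subseq _ _) (subseq_cons _ _).
- by exists (alternating j i d) => //; rewrite -(alternating_take j i dm); exact: take_subseq.
Qed.

Lemma subproduct_hecke0 I J x : hecke0_eq I J -> subproduct I x <-> subproduct J x.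
Proof.
move=> IJ; elim: IJ x => {I J} [//|I J _ IH x|I J K _ IH _ IH' x|I J i x|I J i j m x].
- by split=> /IH.
- by rewrite IH.
- split; apply: subproduct_ctx => {}x; last first.
    by case=> K Ki <-; exists K => //; apply: subseq_trans Ki (subseq_cons _ _).
  have Si y : subproduct [:: i] y <-> y = 1%g \/ y = srefl i.
    split=> [[[|k [|l K]] /=]|[->|->]].
    + by rewrite word_prod_nil => _ <-; left.
    + case: (k =P i) => // -> _ <-; right; by rewrite word_prod_cons word_prod_nil mulg1.
    + by case: (k =P i).
    + by exists [::]; rewrite ?word_prod_nil ?sub0seq.
    + by exists [:: i]; rewrite ?word_prod_cons ?word_prod_nil ?mulg1.
  rewrite -[[:: i; i]]/([:: i] ++ [:: i]) => /subproduct_cat[y [z [/Si Sy /Si Sz ->]]].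
  apply/Si; case: Sy => ->; case: Sz => ->; rewrite ?mul1g ?mulg1 ?srefl2; auto.
- split; apply: subproduct_ctx; last rewrite /m order_sym; exact: subproduct_braid.
Qed.

Lemma subproduct_demazure I x : subproduct I x -> bruhat x (demazure I).
Proof.
have [J rJ IJ] := demazure_reduced I.
by rewrite (subproduct_hecke0 x IJ) => -[K KJ <-]; exact: bruhat_subseq rJ KJ.
Qed.

End Words.

(** * Limits of rational functions in the antidominant direction *)

Section Limit.
Context (D : root_datum).
Local Notation S := (grpalg Rm (rk D)).
Local Notation Q := (Qm D).
Implicit Types (g h : S) (f : Q) (c d : Rm).

Definition cone g := forall k, g@_k != 0 -> positive_vec (- k).

Lemma mcoeffM_neq0 g h m : (g * h)@_m != 0 ->
  exists k l, [/\ g@_k != 0, h@_l != 0 & m = k + l].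
Proof.
move=> gh; apply: contrapT => H; case/eqP: gh; rewrite gmulE gmul.unlock.
rewrite raddf_sum big1_seq //= => k gk; rewrite raddf_sum big1_seq //= => l hl.
rewrite mcoeff_gmon; case: eqP => // e; case: H; exists k, l.
by rewrite !mcoeff_neq0.
Qed.

Lemma coneD g h : cone g -> cone h -> cone (g + h).
Proof.
move=> cg ch k; rewrite mcoeffD => gh; case: (eqVneq (g@_k) 0) => [e|]; last exact: cg.
by apply: ch; rewrite e add0r in gh.
Qed.

Lemma coneM g h : cone g -> cone h -> cone (g * h).
Proof.
move=> cg ch m /mcoeffM_neq0[k [l [gk hl ->]]]; rewrite opprD.
by apply: positive_vecD; [exact: cg | exact: ch].
Qed.

Lemma cone_gmon c k : positive_vec (- k) -> cone (gmon c k).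
Proof. by move=> pk l; rewrite mcoeff_gmon; case: (k =P l) => [<-//|_]; rewrite mulr0n eqxx. Qed.

Lemma cone_gcst c : cone (gcst _ c).
Proof. by apply: cone_gmon; rewrite oppr0; exact: positive_vec0. Qed.

Lemma coneN g : cone g -> cone (- g).
Proof. by move=> cg k; rewrite mcoeffN oppr_eq0; exact: cg. Qed.

Lemma mcoeff_gcst c : (gcst (rk D) c)@_0 = c.
Proof. by rewrite mcoeff_gmon eqxx. Qed.

Lemma mcoeff0M g h : cone g -> cone h -> (g * h)@_0 = g@_0 * h@_0.
Proof.
have van g1 h1 : cone g1 -> cone h1 -> (g1 * h1)@_0 != 0 -> g1@_0 != 0 /\ h1@_0 != 0.
  move=> c1 c2 /mcoeffM_neq0[k [l [gk hl e]]].
  have lk : l = - k by apply: (addrI k); rewrite -e addrN.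
  have k0 : k = 0.
    by apply: positive_vec_antisym (c1 _ gk); rewrite -[k]opprK -lk; exact: c2.
  by move: gk hl; rewrite lk k0 oppr0.
move=> cg ch; pose g' := g - gcst _ g@_0; pose h' := h - gcst _ h@_0.
have g'0 : g'@_0 = 0 by rewrite mcoeffB mcoeff_gcst subrr.
have h'0 : h'@_0 = 0 by rewrite mcoeffB mcoeff_gcst subrr.
have cg' : cone g' by apply: coneD => //; apply/coneN/cone_gcst.
have ch' : cone h' by apply: coneD => //; apply/coneN/cone_gcst.
have -> : g * h = gcst _ (g@_0 * h@_0) + (gcst _ g@_0 * h' + g' * h).
  by rewrite /g' /h' rmorphM /=; ring.
rewrite !mcoeffD mcoeff_gcst; set x := (_ * h')@_0; set y := (g' * h)@_0.
have -> : x = 0.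
  by apply/eqP/negPn/negP => /(van _ _ (@cone_gcst _) ch')[_]; rewrite h'0 eqxx.
have -> : y = 0 by apply/eqP/negPn/negP => /(van _ _ cg' ch)[]; rewrite g'0 eqxx.
by rewrite !addr0.
Qed.

(** [limit f c]: the rational function [f] tends to [c] when [e^-a] tends to 0
    for every simple root [a]; that is, [f] is a quotient of elements supported
    on the negative root cone, and [c] is the quotient of their constant terms. *)
Definition limit f c := exists a b : S,
  [/\ cone a, cone b, b@_0 != 0, a@_0 = c * b@_0
    & f = FracField.tofrac (a : Sm D) / FracField.tofrac (b : Sm D)].

Lemma tofrac_neq0 (b : S) : b@_0 != 0 -> FracField.tofrac (b : Sm D) != 0.
Proof. by apply: contraNneq => /eqP; rewrite tofrac_eq0 => /eqP ->; rewrite mcoeff0. Qed.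

Lemma limit_uniq f c d : limit f c -> limit f d -> c = d.
Proof.
move=> [a [b [ca cb b0 a0 ->]]] [a' [b' [ca' cb' b0' a0' e]]].
move/eqP: e; rewrite eqr_div ?tofrac_neq0 // -!tofracM tofrac_eq => /eqP e.
have := congr1 (mcoeff 0) e; rewrite !mcoeff0M // a0 a0' => e'.
by apply: (mulIf b0); apply: (mulIf b0'); rewrite e' mulrAC.
Qed.

Lemma limitD f1 f2 c1 c2 : limit f1 c1 -> limit f2 c2 -> limit (f1 + f2) (c1 + c2).
Proof.
move=> [a [b [ca cb b0 a0 ->]]] [a' [b' [ca' cb' b0' a0' ->]]].
exists (a * b' + a' * b), (b * b'); split.
- by apply: coneD; apply: coneM.
- exact: coneM.
- by rewrite mcoeff0M // mulf_neq0.
- by rewrite mcoeffD !mcoeff0M // a0 a0'; ring.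
by rewrite addf_div ?tofrac_neq0 // -!tofracM -tofracD.
Qed.

Lemma limitM f1 f2 c1 c2 : limit f1 c1 -> limit f2 c2 -> limit (f1 * f2) (c1 * c2).
Proof.
move=> [a [b [ca cb b0 a0 ->]]] [a' [b' [ca' cb' b0' a0' ->]]].
exists (a * a'), (b * b'); split.
- exact: coneM.
- exact: coneM.
- by rewrite mcoeff0M // mulf_neq0.
- by rewrite !mcoeff0M // a0 a0'; ring.
by rewrite mulf_div -!tofracM.
Qed.

Lemma tofrac_gcst1 : FracField.tofrac (gcst (rk D) 1 : Sm D) = 1.
Proof. exact: tofrac1. Qed.

Lemma limit_cst c : limit (cstQ D c) c.
Proof.
exists (gcst _ c), (gcst _ 1); split; rewrite ?mcoeff_gcst ?mulr1 ?oner_neq0 //.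
- exact: cone_gcst.
- exact: cone_gcst.
by rewrite cstQ.unlock tofrac_gcst1 divr1.
Qed.

Lemma limit_eQ (x : 'cV[int]_(rk D)) : positive_vec (- x) -> x != 0 -> limit (eQ x) 0.
Proof.
move=> px x0; exists (gexp _ x), (gcst _ 1); split; rewrite ?mcoeff_gcst ?oner_neq0 //.
- exact: cone_gmon.
- exact: cone_gcst.
- by rewrite mcoeff_gmon (negPf x0) mul0r.
by rewrite eQ.unlock tofrac_gcst1 divr1.
Qed.

Lemma limitV f c d : limit f c -> c * d = 1 -> limit f^-1 d.
Proof.
move=> [a [b [ca cb b0 a0 ->]]] cd; exists b, a; split=> //.
- by rewrite a0 mulf_neq0 //; apply: contra_eqN cd => /eqP ->; rewrite mul0r eq_sym oner_eq0.
- by rewrite a0 mulrA [d * c]mulrC cd mul1r.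
by rewrite invf_div.
Qed.

Lemma limitN f c : limit f c -> limit (- f) (- c).
Proof.
move=> fc; rewrite -[- f]mulN1r -[- c]mulN1r; apply: limitM fc.
by have := limit_cst (-1); rewrite rmorphN1.
Qed.

Lemma limit0 : limit 0 0.
Proof. by rewrite -[X in limit X](rmorph0 (cstQ D)); exact: limit_cst. Qed.
Lemma limit1 : limit 1 1.
Proof. by rewrite -[X in limit X](rmorph1 (cstQ D)); exact: limit_cst. Qed.

Lemma limit_sum (T : finType) (F : T -> Q) (C : T -> Rm) :
  (forall t, limit (F t) (C t)) -> limit (\sum_t F t) (\sum_t C t).
Proof.
move=> FC; apply: (big_ind2 limit) => [||t _]; [exact: limit0 | | exact: FC].
by move=> ? ? ? ?; exact: limitD.
Qed.

End Limit.

(** * Expanding Demazure-Lusztig elements in the group elements *)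

(** Identities between the coefficients of Demazure-Lusztig elements, with
    [x] standing for [e^-a]. *)
Section CoefIdentities.
Context (F : fieldType) (q x : F) (x0 : x != 0) (x1 : 1 - x != 0).

Let xV : x - 1 != 0. Proof. by rewrite -opprB oppr_eq0. Qed.

Lemma coefp_inv : (q - 1) / (1 - x^-1) = (q - 1) * x * (x - 1)^-1.
Proof. by field; rewrite x0 xV. Qed.

Lemma coefr_mul : (1 - q * x) / (1 - x^-1) * ((1 - q * x^-1) / (1 - x)) =
  (1 - q * x) * (x - q) * ((x - 1) * (1 - x))^-1.
Proof. by field; rewrite x0 xV x1. Qed.

Lemma coefp_add : (q - 1) / (1 - x^-1) + (q - 1) / (1 - x) = q - 1.
Proof. by field; rewrite x0 xV x1. Qed.

Lemma coef_quad : ((q - 1) / (1 - x^-1)) ^+ 2 +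
  (1 - q * x) / (1 - x^-1) * ((1 - q * x^-1) / (1 - x)) = (q - 1) * ((q - 1) / (1 - x^-1)) + q.
Proof. by field; rewrite x0 xV x1. Qed.
End CoefIdentities.

Lemma normalize_split (F : fieldType) (p r t u l m : F) : l != 0 -> m != 0 ->
  (p * t + r * u) / l = p * (t / l) + r * m / l * (u / m).
Proof. by move=> l0 m0; field; rewrite l0 m0. Qed.


Section Expansion.
Context (D : root_datum).
Local Notation W := (weyl D).
Local Notation n := (nsimple D).
Local Notation Q := (Qm D).
Local Notation q := (q D).
Local Notation qh := (qh D).
Local Notation eQ := (@eQ D).
Local Notation tw := (twisted D).
Implicit Types (a b : 'I_(nroots D)) (i j : 'I_n) (u v w x y : W) (z : tw).
Local Opaque weyl_perm ropp w0 weyl_inv.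
Local Notation "w ** a" := (weyl_perm w a) (at level 38, right associativity).

Definition qR : Rm := gexp _ (const_mx 1) ^+ 2.

Lemma q_cst : q = cstQ D qR.
Proof. by rewrite /q /qh -rmorphXn. Qed.

Lemma qh_neq0 : qh != 0.
Proof.
have : qh * cstQ D (gexp _ (- const_mx 1)) = 1.
  by rewrite /qh -rmorphM -gexpD addrN rmorph1.
by apply: contra_eqN => /eqP ->; rewrite mul0r eq_sym oner_eq0.
Qed.

Lemma q_neq0 : q != 0.
Proof. by rewrite expf_neq0 // qh_neq0. Qed.

Lemma actQ_q w : actQ w q = q.
Proof. by rewrite q_cst actQ_cst. Qed.

Lemma cst_eQ_neq1 c (y : 'cV[int]_(rk D)) : y != 0 -> 1 - cstQ D c * eQ y != 0.
Proof.
move=> y0; rewrite subr_eq0 cstQ.unlock eQ.unlock -tofracM -tofrac1 tofrac_eq.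
apply: contraNneq y0 => e; have {e} : gcst (rk D) 1 = gmon c y.
  transitivity (1 : Sm D); first by [].
  by rewrite e gmulE gmulUU mulr1 add0r.
move/(congr1 (mcoeff 0)); rewrite mcoeff_gcst mcoeff_gmon; case: (y =P 0) => // _ /eqP.
by rewrite oner_eq0.
Qed.

Lemma eQ_neq1 a : 1 - eQ (root a) != 0.
Proof. by have := cst_eQ_neq1 1 (root_neq0 a); rewrite rmorph1 mul1r. Qed.

Lemma qeQ_neq1 a : 1 - q * eQ (- root a) != 0.
Proof. by rewrite q_cst cst_eQ_neq1 // oppr_eq0 root_neq0. Qed.

Lemma eQV (y : 'cV[int]_(rk D)) : eQ (- y) = (eQ y)^-1.
Proof.
have e : eQ (- y) * eQ y = 1 by rewrite -eQD addNr eQ0.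
have y0 : eQ y != 0 by apply: contra_eqN e => /eqP ->; rewrite mulr0 eq_sym oner_eq0.
by apply: (mulIf y0); rewrite e mulVf.
Qed.

Lemma eQ_neq0 (y : 'cV[int]_(rk D)) : eQ y != 0.
Proof.
have : eQ (- y) * eQ y = 1 by rewrite -eQD addNr eQ0.
by apply: contra_eqN => /eqP ->; rewrite mulr0 eq_sym oner_eq0.
Qed.

(** The coefficients of [1] and of the reflection in [tau], for an arbitrary
    root. *)
Definition coefp a : Q := (q - 1) / (1 - eQ (root a)).
Definition coefr a : Q := (1 - q * eQ (- root a)) / (1 - eQ (root a)).

Lemma coefr_neq0 a : coefr a != 0.
Proof. exact: mulf_neq0 (qeQ_neq1 a) (invr_neq0 (eQ_neq1 a)). Qed.

Lemma actQ_coefp w a : actQ w (coefp a) = coefp (w ** a).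
Proof. by rewrite fmorph_div !rmorphB !rmorph1 /= actQ_q actQ_eQ /coefp weyl_permE. Qed.

Lemma actQ_coefr w a : actQ w (coefr a) = coefr (w ** a).
Proof.
rewrite fmorph_div !rmorphB !rmorph1 /= rmorphM /= actQ_q !actQ_eQ /coefr weyl_permE.
by rewrite mulmxN.
Qed.

Lemma eQ_rootE a : eQ (root a) = (eQ (- root a))^-1.
Proof. by rewrite -eQV opprK. Qed.

Lemma eQN_neq1 a : 1 - eQ (- root a) != 0.
Proof. by rewrite -root_ropp eQ_neq1. Qed.

Lemma coefp_ropp a : coefp a + coefp (ropp a) = q - 1.
Proof. by rewrite /coefp root_ropp (eQ_rootE a) (coefp_add q (eQ_neq0 _) (eQN_neq1 a)). Qed.

Lemma coefr_ropp a : coefr a * coefr (ropp a) = (q - 1) * coefp a + q - coefp a ^+ 2.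
Proof.
rewrite /coefp /coefr root_ropp opprK (eQ_rootE a) -(coef_quad q (eQ_neq0 _) (eQN_neq1 a)).
by rewrite [RHS]addrC addKr.
Qed.

Lemma limit_q : limit q qR.
Proof. by rewrite q_cst; exact: limit_cst. Qed.

Lemma limit_eQN a : posroot a -> limit (eQ (- root a)) 0.
Proof. by move=> pa; apply: limit_eQ; rewrite ?opprK // oppr_eq0 root_neq0. Qed.

Lemma limitB f1 f2 c1 c2 : limit f1 c1 -> limit f2 c2 -> limit (D := D) (f1 - f2) (c1 - c2).
Proof. by move=> h1 h2; apply: limitD h1 (limitN h2). Qed.

Lemma limit_coefp_pos a : posroot a -> limit (coefp a) 0.
Proof.
move=> pa; rewrite /coefp (eQ_rootE a) (coefp_inv q (eQ_neq0 _) (eQN_neq1 a)).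
have la := limit_eQN pa; have lq := limitB limit_q (limit1 D).
have -> : 0 = (qR - 1) * 0 * (- 1) by rewrite mulr0 mul0r.
apply: limitM; first exact: limitM.
by apply: limitV; [apply: limitB la (limit1 D) | rewrite sub0r mulrNN mulr1].
Qed.

Lemma limit_coefp_neg a : ~~ posroot a -> limit (coefp a) (qR - 1).
Proof.
rewrite -posroot_ropp => /limit_eQN; rewrite root_ropp opprK => la.
have lq := limitB limit_q (limit1 D); rewrite -[qR - 1]mulr1; apply: limitM => //.
by apply: limitV; [apply: limitB (limit1 D) la | rewrite subr0 mulr1].
Qed.

Lemma limit_coefr_ropp a : posroot a -> limit (coefr a * coefr (ropp a)) qR.
Proof.
move=> pa; rewrite /coefr root_ropp opprK (eQ_rootE a) (coefr_mul q (eQ_neq0 _) (eQN_neq1 a)).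
have la := limit_eQN pa; have l1 := limit1 D.
have -> : qR = (1 - qR * 0) * (0 - qR) * (- 1).
  by rewrite mulr0 subr0 mul1r sub0r mulrNN mulr1.
apply: limitM; first by apply: limitM; [exact: limitB l1 (limitM limit_q la) | exact: limitB la limit_q].
apply: limitV; first by apply: limitM; [exact: limitB la l1 | exact: limitB l1 la].
by rewrite sub0r subr0 mulr1 mulrNN mulr1.
Qed.

(** The coefficient of [delta w] in [tau_weyl w]. *)
Definition lead w : Q := \prod_(a in inversions w) coefr a.

Lemma lead1 : lead 1%g = 1.
Proof. by rewrite /lead inversions1 big_set0. Qed.

Lemma lead_neq0 w : lead w != 0.
Proof. by apply/prodf_neq0 => a _; exact: coefr_neq0. Qed.

Lemma lead_srefl i w : posroot (w^-1%g ** simple i) ->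
  lead (srefl i * w)%g = coefr (simple i) * actQ (srefl i) (lead w).
Proof.
move=> pi; rewrite /lead (inversions_srefl pi) big_setU1 ?simple_notin_inversions //=; congr (_ * _).
rewrite big_imset /=; last by move=> ? ? _ _; exact: weyl_perm_injr.
by rewrite rmorph_prod; apply: eq_bigr => a _; rewrite /= actQ_coefr.
Qed.

Lemma tauE i : tau i = coefp (simple i) *: 1 + coefr (simple i) *: delta (srefl i).
Proof. by []. Qed.

Lemma delta_mulE w z x : (delta w * z) x = actQ w (z (w^-1 * x)%g).
Proof.
rewrite twM twmulE (bigD1 w) //= big1 ?addr0 => [|v vw]; rewrite deltaE ?eqxx ?mul1r //.
by rewrite (negPf vw) mul0r.
Qed.

Lemma tau_mulE i z x : (tau i * z) x =
  coefp (simple i) * z x + coefr (simple i) * actQ (srefl i) (z (srefl i * x)%g).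
Proof.
have add2 (y1 y2 : tw) : ((y1 + y2) * z) x = (y1 * z) x + (y2 * z) x.
  by rewrite mulrDl; exact: twaddE.
have scale2 (p : Q) (y : tw) : ((p *: y) * z) x = p * (y * z) x.
  by rewrite -scalerAl; exact: twscaleE.
apply: etrans (add2 _ _) _; congr (_ + _); apply: etrans (scale2 _ _) _; congr (_ * _).
  by rewrite mul1r.
by rewrite delta_mulE sreflV.
Qed.

Lemma tau_seq_cons i I : tau_seq (i :: I) = tau i * tau_seq I.
Proof. exact: big_cons. Qed.
Lemma tau_seq_cat I J : @tau_seq D (I ++ J) = tau_seq I * tau_seq J.
Proof. exact: big_cat. Qed.
Lemma tau_seq_nil : @tau_seq D [::] = 1.
Proof. exact: big_nil. Qed.

Lemma delta1E x : (1 : tw) x = (x == 1%g)%:R.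
Proof. by rewrite tw1E deltaE. Qed.

(** The coefficient of [delta x], divided by that of [delta x] in [tau_weyl x]
    and transported to the chamber of [x]. *)
Definition normal_coef z x : Q := actQ x^-1%g (z x / lead x).

(** In the limit the normalized coefficients follow the regular representation
    of the Hecke algebra, so a reduced word of [w] only retains [w]. *)
Lemma limit_tau_seq I w : reduced_word I w ->
  forall x, limit (normal_coef (tau_seq I) x) (x == w)%:R.
Proof.
elim: I w => [|i I IH] w.
  case/andP=> /eqP <- _ x; rewrite word_prod_nil /normal_coef tau_seq_nil delta1E.
  case: eqP => [->|_]; first by rewrite lead1 divr1 rmorph1; exact: limit1.
  by rewrite mul0r rmorph0; exact: limit0.
move=> /reduced_cons[rI pi] x; have {}IH := IH _ rI; set v := (srefl i * w)%g in IH.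
have pv : posroot (v^-1%g ** simple i) by rewrite posroot_srefl.
have xV : (x^-1 * srefl i)%g = (srefl i * x)^-1%g by rewrite invMg sreflV.
have e : normal_coef (tau_seq (i :: I)) x =
   coefp (x^-1%g ** simple i) * normal_coef (tau_seq I) x +
   actQ x^-1%g (coefr (simple i) * actQ (srefl i) (lead (srefl i * x)%g) / lead x) *
     normal_coef (tau_seq I) (srefl i * x)%g.
  rewrite /normal_coef tau_seq_cons tau_mulE -actQ_coefp -[in RHS]xV.
  have ls : actQ (srefl i) (lead (srefl i * x)%g) != 0 by rewrite fmorph_eq0 lead_neq0.
  rewrite (normalize_split _ _ _ _ (lead_neq0 x) ls) rmorphD rmorphM; congr (_ + _).
  by rewrite rmorphM (actQ_mul x^-1%g (srefl i)); congr (_ * actQ _ _); rewrite fmorph_div.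
rewrite {}e; case px: (posroot (x^-1%g ** simple i)).
  (* [i] is an ascent of [x] and a descent of [w], so [x] is not [w]; the first
     coefficient tends to 0 and the second one to [qR] *)
  have xw : (x == w) = false by apply: contraTF px => /eqP ->.
  have -> : (x == w)%:R = 0 * (x == v)%:R + qR * ((srefl i * x)%g == v)%:R :> Rm.
    by rewrite (inj_eq (mulgI _)) xw mul0r mulr0 addr0.
  apply: limitD; first exact: limitM (limit_coefp_pos px) (IH _).
  apply: limitM (IH _).
  have -> : actQ (srefl i) (lead (srefl i * x)%g) = coefr (ropp (simple i)) * lead x.
    rewrite (lead_srefl px) rmorphM; congr (_ * _).
      exact: etrans (actQ_coefr _ _) (congr1 coefr (srefl_simple i)).
    by apply: etrans (esym (actQ_mul _ _ _)) _; rewrite srefl2 actQ1.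
  rewrite mulrA (mulfK (lead_neq0 x)) rmorphM /=.
  have -> : actQ x^-1%g (coefr (simple i)) = coefr (x^-1%g ** simple i) by exact: actQ_coefr.
  have -> : actQ x^-1%g (coefr (ropp (simple i))) = coefr (ropp (x^-1%g ** simple i)).
    by rewrite actQ_coefr (weyl_perm_ropp x^-1%g).
  exact: limit_coefr_ropp.
(* [i] is a descent of [x] and an ascent of [v], so the first term tends to 0;
   the second coefficient is 1 *)
have xv : (x == v) = false by apply: contraFF px => /eqP ->.
have -> : (x == w)%:R = (qR - 1) * (x == v)%:R + 1 * ((srefl i * x)%g == v)%:R :> Rm.
  by rewrite (inj_eq (mulgI _)) xv mulr0 add0r mul1r.
apply: limitD; first by apply: limitM (limit_coefp_neg _) (IH _); rewrite px.
apply: limitM (IH _); have := @lead_srefl i (srefl i * x)%g; rewrite sreflK posroot_srefl px.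
by move=> /(_ isT) <-; rewrite divff ?lead_neq0 // rmorph1; exact: limit1.
Qed.

Lemma tau_seq_support I x : tau_seq I x != 0 -> subproduct I x.
Proof.
elim: I x => [|i I IH] x.
  rewrite tau_seq_nil delta1E; case: (x =P 1%g) => [-> _|_ /eqP//].
  by exists [::]; rewrite ?word_prod_nil.
rewrite tau_seq_cons tau_mulE => nz; case: (eqVneq (tau_seq I x) 0) => [e0|/IH[K KI <-]].
  have : tau_seq I (srefl i * x)%g != 0.
    by apply: contraNneq nz => ->; rewrite e0 rmorph0 !mulr0 addr0.
  case/IH=> K KI Kx; exists (i :: K); first by rewrite /= eqxx.
  by rewrite word_prod_cons Kx sreflK.
by exists K => //; apply: subseq_trans KI (subseq_cons _ _).
Qed.

Lemma subproduct_reduced I w x : reduced_word I w -> subproduct I x -> bruhat x w.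
Proof. by move=> rI [K KI <-]; exact: bruhat_subseq rI KI. Qed.

Lemma tau_weyl_support w x : tau_weyl w x != 0 -> bruhat x w.
Proof. by move/tau_seq_support; apply: subproduct_reduced; exact: redwordP. Qed.

Lemma tau_seq_lead I w : reduced_word I w -> tau_seq I w = lead w.
Proof.
elim: I w => [|i I IH] w.
  by case/andP=> /eqP <- _; rewrite word_prod_nil tau_seq_nil delta1E eqxx lead1.
move=> /reduced_cons[rI pi]; rewrite tau_seq_cons tau_mulE (IH _ rI).
have -> : tau_seq I w = 0.
  apply/eqP/negPn/negP => /tau_seq_support/(subproduct_reduced rI)/bruhat_len.
  have lw := len_descent pi; case=> [e|]; last by rewrite lw ltnNge ltnW.
  by move: lw; rewrite -e => /eqP; rewrite -{1}[len w]addn0 -addn1 eqn_add2l.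
rewrite mulr0 add0r -lead_srefl ?sreflK //.
by rewrite posroot_srefl.
Qed.

Lemma tau_weyl_lead w : tau_weyl w w = lead w.
Proof. by apply: tau_seq_lead; exact: redwordP. Qed.

End Expansion.

(** * The Hecke algebra *)

(** The inverse of an element satisfying a quadratic relation with invertible
    constant term, in an algebra whose scalars need not be central. *)
Lemma quadratic_inverse (F : fieldType) (A : lalgType F) (t : A) (a b : F) :
  (forall z, t * (b^-1 *: z) = b^-1 *: (t * z)) -> t * (a *: 1) = a *: t ->
  t * t = a *: t + b *: 1 -> b != 0 ->
  t * (b^-1 *: (t - a *: 1)) = 1 /\ (b^-1 *: (t - a *: 1)) * t = 1.
Proof.
move=> tb ta tt b0; split; first by rewrite tb mulrBr ta tt addrC addKr scalerA mulVf ?scale1r.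
by rewrite -scalerAl mulrBl -scalerAl mul1r tt addrC addKr scalerA mulVf ?scale1r.
Qed.

Lemma quadratic_inverse_mul (F : fieldType) (A : lalgType F) (t z : A) (a b : F) :
  (b^-1 *: (t - a *: 1)) * z = b^-1 *: (t * z - a *: z).
Proof. by rewrite -scalerAl mulrBl -scalerAl mul1r. Qed.

Section Hecke.
Context (D : root_datum).
Local Notation W := (weyl D).
Local Notation n := (nsimple D).
Local Notation Q := (Qm D).
Local Notation q := (q D).
Local Notation qh := (qh D).
Local Notation tw := (twisted D).
Implicit Types (a b : 'I_(nroots D)) (i j : 'I_n) (u v w x : W) (z : tw).
Local Opaque weyl_perm ropp w0 weyl_inv tau tau_seq.
Local Notation "w ** a" := (weyl_perm w a) (at level 38, right associativity).

Lemma tw_mulZr (c : Q) z1 z2 : (forall w, actQ w c = c) -> z1 * (c *: z2) = c *: (z1 * z2).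
Proof.
move=> cW; apply/ffunP => x; rewrite twscaleE !twM !twmulE mulr_sumr.
by apply: eq_bigr => w _; rewrite twscaleE rmorphM /= cW mulrCA.
Qed.

Lemma actQ_q1 w : actQ w (q - 1) = q - 1.
Proof. by rewrite rmorphB rmorph1 /= actQ_q. Qed.

Lemma actQ_qV w : actQ w q^-1 = q^-1.
Proof. by rewrite fmorphV /= actQ_q. Qed.

Lemma tau_coef i x : tau i x =
  coefp (simple i) * (x == 1%g)%:R + coefr (simple i) * (x == srefl i)%:R.
Proof.
rewrite tauE -delta1E -deltaE; apply: etrans (twaddE _ _ x) _.
by congr (_ + _); exact: twscaleE.
Qed.

Lemma tau_quadratic i : tau i * tau i = (q - 1) *: tau i + q *: (1 : tw).
Proof.
have sp : actQ (srefl i) (coefp (simple i)) = q - 1 - coefp (simple i).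
  by rewrite actQ_coefp srefl_simple -(coefp_ropp (simple i)) addrC addKr.
have sr := coefr_ropp (simple i); rewrite -srefl_simple -actQ_coefr in sr.
apply/ffunP => x.
have rE : ((q - 1) *: tau i + q *: (1 : tw)) x = (q - 1) * tau i x + q * (x == 1%g)%:R.
  rewrite -delta1E.
  exact: etrans (twaddE _ _ x) (congr2 +%R (twscaleE _ _ x) (twscaleE _ _ x)).
apply: etrans (tau_mulE i (tau i) x) _.
apply: etrans (esym rE).
rewrite (tau_coef i x) (tau_coef i (srefl i * x)%g).
have -> : ((srefl i * x)%g == 1%g) = (x == srefl i).
  by rewrite -[in LHS](srefl2 i) (inj_eq (mulgI _)).
have -> : ((srefl i * x)%g == srefl i) = (x == 1%g).
  by rewrite -[X in _ == X]mulg1 (inj_eq (mulgI _)).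
have actE (p r : Q) (b b' : bool) : actQ (srefl i) (p * b%:R + r * b'%:R) =
    actQ (srefl i) p * b%:R + actQ (srefl i) r * b'%:R.
  by rewrite rmorphD !rmorphM !rmorph_nat.
rewrite actE sp.
move: (coefp _) (coefr _) (actQ _ _) sr (x == 1%g)%:R (x == srefl i)%:R => p r r' sr b1 b2.
rewrite (_ : p * (p * b1 + r * b2) + _ = p ^+ 2 * b1 + (q - 1) * r * b2 + r * r' * b1); last by ring.
by rewrite sr; ring.
Qed.

(** [tau i] is invertible because its quadratic relation has unit constant term. *)
Definition tauV i : tw := q^-1 *: (tau i - (q - 1) *: 1).

Lemma tauV_inverse i : tau i * tauV i = 1 /\ tauV i * tau i = 1.
Proof.
apply: quadratic_inverse (tau_quadratic i) (q_neq0 D) => [z|].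
  exact: (tw_mulZr _ _ actQ_qV).
by apply: etrans (tw_mulZr _ _ actQ_q1) _; rewrite mulr1.
Qed.

Lemma tau_unit i : tau i \is a GRing.unit.
Proof. by apply/unitrP; exists (tauV i); have [] := tauV_inverse i. Qed.

Lemma tau_inv i : (tau i)^-1 = tauV i.
Proof.
by apply: (mulrI (tau_unit i)); rewrite mulrV ?tau_unit //; have [->] := tauV_inverse i.
Qed.

Lemma tau_seq_unit I : @tau_seq D I \is a GRing.unit.
Proof.
elim: I => [|i I IH]; first by rewrite tau_seq_nil unitr1.
by rewrite tau_seq_cons unitrMr ?tau_unit.
Qed.

Lemma tw_subZE (a b : Q) (y z : tw) x : (b *: (y - a *: z) : tw) x = b * (y x - a * z x).
Proof. by rewrite twscaleE twaddE -scaleNr twscaleE mulNr. Qed.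

Lemma tauV_mulE i z x : (tauV i * z) x = q^-1 * ((tau i * z) x - (q - 1) * z x).
Proof.
rewrite /tauV; apply: etrans (congr1 (fun y : tw => y x) (quadratic_inverse_mul _ _ _ _)) _.
exact: tw_subZE.
Qed.

Lemma tau_seq_inv_rcons I i : (tau_seq (rcons I i))^-1 = tauV i * (tau_seq I)^-1.
Proof.
rewrite -cats1 tau_seq_cat tau_seq_cons tau_seq_nil mulr1 -tau_inv.
by rewrite invrM ?tau_unit ?tau_seq_unit.
Qed.

(** As [tau i] and [1] span the inverse of [tau i], inverting a word reverses its
    letters without introducing others. *)
Lemma tau_seqV_support I x : (tau_seq I)^-1 x != 0 -> subproduct (rev I) x.
Proof.
elim/last_ind: I x => [|I i IH] x.
  rewrite tau_seq_nil invr1 delta1E; case: (x =P 1%g) => [-> _|_ /eqP//].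
  by exists [::]; rewrite ?word_prod_nil.
rewrite tau_seq_inv_rcons tauV_mulE tau_mulE rev_rcons => nz; set y := (tau_seq I)^-1 in IH nz.
case: (eqVneq (y x) 0) => [e0|/IH[K KI <-]]; last first.
  by exists K => //; apply: subseq_trans KI (subseq_cons _ _).
have : y (srefl i * x)%g != 0.
  by apply: contraNneq nz => ->; rewrite e0 rmorph0 !mulr0 addr0 subr0 mulr0.
case/IH=> K KI Kx; exists (i :: K); first by rewrite /= eqxx.
by rewrite word_prod_cons Kx sreflK.
Qed.

Lemma tau_seqV_lead I w : reduced_word (rev I) w ->
  (tau_seq I)^-1 w = q ^- size I * lead w.
Proof.
elim/last_ind: I w => [|I i IH] w.
  case/andP=> /eqP <- _; rewrite word_prod_nil tau_seq_nil invr1 delta1E eqxx lead1.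
  by rewrite expr0 invr1 mulr1.
rewrite rev_rcons => /reduced_cons[rI pi]; rewrite tau_seq_inv_rcons tauV_mulE tau_mulE (IH _ rI).
have -> : (tau_seq I)^-1 w = 0.
  apply/eqP/negPn/negP => /tau_seqV_support/(subproduct_reduced rI)/bruhat_len.
  have lw := len_descent pi; case=> [e|]; last by rewrite lw ltnNge ltnW.
  by move: lw; rewrite -e => /eqP; rewrite -{1}[len w]addn0 -addn1 eqn_add2l.
have -> : lead w = coefr (simple i) * actQ (srefl i) (lead (srefl i * w)%g).
  by rewrite -lead_srefl ?sreflK // posroot_srefl.
have qW : actQ (srefl i) (q ^- size I) = q ^- size I by rewrite fmorphV rmorphXn /= actQ_q.
rewrite !mulr0 subr0 add0r rmorphM /= qW size_rcons exprS (invfM q).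
by rewrite -mulrA; congr (_ * _); rewrite mulrCA.
Qed.

Section WithConstants.
Context (c : seq 'I_n -> W -> Rm)
  (hc : forall I, tau_seq I = \sum_w cstQ D (c I w) *: tau_weyl w).

Lemma twsumE (T : finType) (F : T -> tw) x : (\sum_t F t) x = \sum_t F t x.
Proof. by elim/big_rec2: _ => [|t y z _ <-]; rewrite ?ffunE. Qed.

(** The structure coefficients are constants, so each of them is its own limit,
    and [limit_tau_seq] computes this limit. *)
Lemma tau_reduced I w : reduced_word I w -> tau_seq I = tau_weyl w.
Proof.
move=> rI; suff cE x : c I x = (x == w)%:R.
  rewrite hc (bigD1 w) //= big1 ?addr0 => [|x xw].
    by rewrite cE eqxx rmorph1 scale1r.
  by rewrite cE (negPf xw) rmorph0 scale0r.
apply: limit_uniq (limit_tau_seq rI x); rewrite hc.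
have -> : normal_coef (\sum_y cstQ D (c I y) *: tau_weyl y) x =
    \sum_y cstQ D (c I y) * normal_coef (tau_weyl y) x.
  rewrite /normal_coef twsumE mulr_suml rmorph_sum; apply: eq_bigr => y _ /=.
  by rewrite twscaleE -mulrA rmorphM /= actQ_cst.
have -> : c I x = \sum_y c I y * (x == y)%:R.
  rewrite (bigD1 x) //= eqxx mulr1 big1 ?addr0 // => y yx.
  by rewrite eq_sym (negPf yx) mulr0.
apply: limit_sum => y; apply: limitM; first exact: limit_cst.
exact/limit_tau_seq/redwordP.
Qed.

Lemma tau_mul_ascent i w : posroot (w^-1%g ** simple i) ->
  tau i * tau_weyl w = tau_weyl (srefl i * w)%g.
Proof.
move=> pi; rewrite -tau_seq_cons; apply: tau_reduced.
exact: reduced_ascent (redwordP w) pi.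
Qed.

Lemma tau_mul_descent i w : ~~ posroot (w^-1%g ** simple i) ->
  tau i * tau_weyl w = (q - 1) *: tau_weyl w + q *: tau_weyl (srefl i * w)%g.
Proof.
move=> pi; have e : tau_weyl w = tau i * tau_weyl (srefl i * w)%g.
  by rewrite tau_mul_ascent ?sreflK // posroot_srefl.
by rewrite {1}e mulrA tau_quadratic mulrDl -!scalerAl mul1r -e.
Qed.

Lemma tau_weylM u v : len (u * v)%g = (len u + len v)%N ->
  tau_weyl (u * v)%g = tau_weyl u * tau_weyl v.
Proof.
move=> luv; rewrite -[RHS]tau_seq_cat; apply/esym/tau_reduced.
have /andP[/eqP eu /eqP su] := redwordP u; have /andP[/eqP ev /eqP sv] := redwordP v.
by rewrite /reduced_word word_prod_cat eu ev luv size_cat su sv !eqxx.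
Qed.

End WithConstants.
End Hecke.

(** * The stable basis as a dual basis *)

Lemma dual_scalar (F : fieldType) (a b p l : F) : a != 0 -> b != 0 ->
  a / b * (p * (b ^+ 2 * (a^-1 * l))) = b * (p * l).
Proof. by move=> a0 b0; field; rewrite a0 b0. Qed.

Section Stable.
Context (D : root_datum).
Local Notation W := (weyl D).
Local Notation n := (nsimple D).
Local Notation Q := (Qm D).
Local Notation q := (q D).
Local Notation qh := (qh D).
Local Notation tw := (twisted D).
Implicit Types (a b : 'I_(nroots D)) (i j : 'I_n) (u v w x : W) (z : tw).
Local Opaque weyl_perm ropp w0 weyl_inv tau tau_seq.
Local Notation "w ** a" := (weyl_perm w a) (at level 38, right associativity).

Lemma reduced_rev I w : reduced_word I w -> reduced_word (rev I) w^-1%g.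
Proof.
by case/andP=> /eqP <- /eqP sI; rewrite /reduced_word word_prod_rev eqxx size_rev sI lenV /=.
Qed.

Lemma mul_coefr a : (1 - eQ (root a)) * coefr a = 1 - q * eQ (- root a).
Proof. by rewrite mulrC (mulfVK (eQ_neq1 a)). Qed.

Lemma hatx_inversions w : hatx w = \prod_(a in inversions w) (1 - q * eQ (- root a)).
Proof.
by apply: eq_bigl => a; rewrite inE posrootN weyl_permE.
Qed.

Lemma hatx_w0 : hatx (w0 D) = \prod_(a | posroot a) (1 - eQ (root a)) * lead (w0 D).
Proof.
rewrite hatx_inversions /lead inversions_w0.
rewrite (eq_bigl (fun a => posroot a)) => [|a]; last by rewrite inE.
rewrite [X in _ * X](eq_bigl (fun a => posroot a)) => [|a]; last by rewrite inE.
by rewrite -big_split; apply: eq_bigr => a _; rewrite /= mul_coefr.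
Qed.

Lemma hatx_neq0 w : hatx w != 0.
Proof. by apply/prodf_neq0 => a _; exact: qeQ_neq1. Qed.

Context (c : seq 'I_n -> W -> Rm)
  (hc : forall I, tau_seq I = \sum_w cstQ D (c I w) *: tau_weyl w).

Let tw0 := tau_weyl (w0 D).

(** The coefficient of [delta w0] in [z * (tau w0)^-1]. On the Hecke algebra it
    is, up to a scalar, the symmetrizing trace, because
    [tau w * (tau w0)^-1 = (tau (w0 * w^-1))^-1] is too short to reach [w0]
    unless [w = 1]. *)
Definition trace z : Q := (z * tw0^-1) (w0 D).

Lemma traceD z1 z2 : trace (z1 + z2) = trace z1 + trace z2.
Proof. by rewrite /trace mulrDl; exact: twaddE. Qed.

Lemma traceZ (p : Q) z : trace (p *: z) = p * trace z.
Proof. by rewrite /trace -scalerAl; exact: twscaleE. Qed.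

Lemma trace_mul2 z z1 z2 :
  trace (z * ((q - 1) *: z1 + q *: z2)) = (q - 1) * trace (z * z1) + q * trace (z * z2).
Proof.
have -> : z * ((q - 1) *: z1 + q *: z2) = (q - 1) *: (z * z1) + q *: (z * z2).
  apply: etrans (mulrDr _ _ _) _.
  by congr (_ + _); [exact: (tw_mulZr _ _ (@actQ_q1 D)) | exact: (tw_mulZr _ _ (@actQ_q D))].
by apply: etrans (traceD _ _) _; congr (_ + _); exact: traceZ.
Qed.

Lemma trace_tau_weyl w :
  trace (tau_weyl w) = (w == 1%g)%:R * (q ^- len (w0 D) * lead (w0 D)).
Proof.
pose v := (w0 D * w^-1)%g; have vw : (v * w)%g = w0 D by rewrite mulgKV.
have lv : (len v + len w)%N = len (w0 D) by have := len_w0M w^-1%g; rewrite lenV.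
have e : tau_weyl w * tw0^-1 = (tau_weyl v)^-1.
  have -> : tw0 = tau_weyl v * tau_weyl w.
    by rewrite /tw0 -[in LHS]vw; apply: (tau_weylM hc); rewrite vw lv.
  by rewrite invrM ?tau_seq_unit // mulrA mulrV ?tau_seq_unit // mul1r.
rewrite /trace {}e; case: (w =P 1%g) => [w1|/eqP w1].
  have ev : v = w0 D by rewrite /v w1 invg1 mulg1.
  rewrite mul1r ev; have r0 := redwordP (w0 D).
  have := tau_seqV_lead (I := redword (w0 D)) (w := w0 D).
  rewrite -[X in reduced_word _ X](w0V D) => /(_ (reduced_rev r0)) ->.
  by case/andP: r0 => _ /eqP ->.
rewrite mul0r; apply/eqP/negPn/negP => /tau_seqV_support[K Kv Kw0].
have := len_le_word K; rewrite Kw0 -lv => le; have /andP[_ /eqP sv] := redwordP v.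
have := leq_trans le (size_subseq Kv); rewrite size_rev sv -{2}[len v]addn0 leq_add2l leqn0.
by move=> /eqP/len_eq1 e; rewrite e eqxx in w1.
Qed.

Lemma trace_tau_seqM I u v : reduced_word I u ->
  trace (tau_seq (rev I) * tau_weyl v) =
    q ^+ size I * (v == u)%:R * (q ^- len (w0 D) * lead (w0 D)).
Proof.
elim: I u v => [|i I IH] u v.
  case/andP=> /eqP <- _; rewrite word_prod_nil tau_seq_nil mul1r trace_tau_weyl.
  by rewrite expr0 mul1r.
move=> /reduced_cons[rI pi]; rewrite rev_cons -cats1 tau_seq_cat tau_seq_cons tau_seq_nil mulr1.
rewrite -mulrA; have pv : posroot ((srefl i * u)^-1%g ** simple i) by rewrite posroot_srefl.
case pw: (posroot (v^-1%g ** simple i)).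
  rewrite (tau_mul_ascent hc pw) (IH _ _ rI) (inj_eq (mulgI _)).
  have -> : (v == u) = false by apply: contraTF pw => /eqP ->.
  by rewrite !mulr0.
rewrite (tau_mul_descent hc (negbT pw)) trace_mul2 !(IH _ _ rI).
have -> : (v == srefl i * u)%g = false by apply: contraFF pw => /eqP ->.
by rewrite (inj_eq (mulgI _)) mulr0 mul0r mulr0 add0r exprS !mulrA.
Qed.

(** As [tau w0] is [tau (w0 * u) * tau u^-1], the value is, up to scalars, the
    trace of [tau w * tau u^-1]. *)
Lemma stab_tau_weyl u w :
  stab u (tau_weyl w) = (u == w)%:R * (qh ^+ len u * hatx (w0 D)).
Proof.
have lu : len (w0 D) = (len (w0 D * u)%g + len u^-1%g)%N by rewrite lenV len_w0M.
have tE : tw0 = tau_weyl (w0 D * u)%g * tau_weyl u^-1%g.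
  rewrite /tw0 -[in LHS](mulgK u (w0 D)); apply: (tau_weylM hc).
  by rewrite mulgK.
have e : (tau_weyl (w0 D * u)%g)^-1 = tau_weyl u^-1%g * tw0^-1.
  by rewrite tE invrM ?tau_seq_unit // mulrA mulrV ?tau_seq_unit // mul1r.
have H : (tau_weyl w * (tau_weyl (w0 D * u)%g)^-1) (w0 D) =
    q ^+ len w * (u == w)%:R * (q ^- len (w0 D) * lead (w0 D)).
  rewrite e mulrA -/(trace _).
  have rw := reduced_rev (redwordP w).
  have := trace_tau_seqM u^-1%g rw; rewrite revK size_rev (inj_eq invg_inj) => ->.
  by case/andP: (redwordP w) => _ /eqP ->.
rewrite /stab; set P := \prod_(a | _) _.
have -> (k : Q) (f : twisted_dual D) : (k *: f) (tau_weyl w) = k * f (tau_weyl w).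
  exact: scale_lfunE.
rewrite bulletE.
have -> (k : Q) (f : twisted_dual D) (z : tw) : (k *: f) z = k * f z by exact: scale_lfunE.
rewrite fdualE H hatx_w0 -/P.
case: (u =P w) => [->|_]; last by rewrite mulr0 !mul0r !mulr0.
have q0 : q ^+ len (w0 D) != 0 by exact: expf_neq0 (q_neq0 D).
have h0 : qh ^+ len w != 0 by exact: expf_neq0 (qh_neq0 D).
have -> : q ^+ len w = (qh ^+ len w) ^+ 2 by exact: exprAC.
rewrite mulr1 mul1r; exact: dual_scalar q0 h0.
Qed.

End Stable.

(** * The coproduct of a product of Demazure-Lusztig elements *)

Section ConsSet.
Context (m : nat).

Definition cons_set (b : bool) (E : {set 'I_m}) : {set 'I_m.+1} :=
  [set j | if unlift ord0 j is Some k then k \in E else b].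

Lemma cons_set0 b E : (ord0 \in cons_set b E) = b.
Proof. by rewrite inE unlift_none. Qed.

Lemma cons_setS b E k : (lift ord0 k \in cons_set b E) = (k \in E).
Proof. by rewrite inE liftK. Qed.

Lemma big_cons_set (V : nmodType) (G : {set 'I_m.+1} -> V) :
  \sum_E G E = \sum_(E : {set 'I_m}) (G (cons_set true E) + G (cons_set false E)).
Proof.
pose f (p : bool * {set 'I_m}) := cons_set p.1 p.2.
pose f' (E : {set 'I_m.+1}) := (ord0 \in E, [set k | lift ord0 k \in E]).
have fK : cancel f f'.
  move=> [b E]; rewrite /f /f' cons_set0; congr (_, _); apply/setP => k.
  by rewrite inE cons_setS.
have f'K : cancel f' f.
  move=> E; apply/setP => j; rewrite inE; case: unliftP => [k ->|->] //.
  by rewrite inE.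
rewrite (reindex f); last by exists f' => ? _; [exact: fK | exact: f'K].
by rewrite -(pair_bigA _ (fun b E => G (cons_set b E))) /= big_bool big_split.
Qed.
End ConsSet.

(** As [delta] is [r^-1 *: (tau - p)], the product of the values of two forms at
    multiples of [delta] splits into four terms. Here [tf] and [tg] are values at
    multiples of [tau], [f] and [g] are the values with [tau] omitted, and [sP] is
    the reflected coefficient. *)
Lemma coproduct_step (F : fieldType) (p r P sP f tf g tg : F) : r != 0 ->
  p * (P * f * g) + r * (sP * (r^-1 * (tf - p * f)) * (r^-1 * (tg - p * g))) =
  r^-1 * sP * tf * tg + (- p / r) * sP * tf * g +
  ((- p / r) * sP * f * tg + (p / r * (p * sP + r * P)) * f * g).
Proof. by move=> r0; field; rewrite r0. Qed.

Section Coproduct.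
Context (D : root_datum).
Local Notation W := (weyl D).
Local Notation n := (nsimple D).
Local Notation Q := (Qm D).
Local Notation q := (q D).
Local Notation qh := (qh D).
Local Notation tw := (twisted D).
Implicit Types (i j : 'I_n) (u v w x : W) (z : tw).
Local Opaque weyl_perm ropp w0 weyl_inv tau tau_seq.

Lemma actQD w (x y : Q) : actQ w (x + y) = actQ w x + actQ w y.
Proof. exact: rmorphD. Qed.
Lemma actQM w (x y : Q) : actQ w (x * y) = actQ w x * actQ w y.
Proof. exact: rmorphM. Qed.
Lemma actQ_sum w (T : finType) (F : T -> Q) : actQ w (\sum_t F t) = \sum_t actQ w (F t).
Proof. exact: rmorph_sum. Qed.
Lemma actQK w (x : Q) : actQ w^-1%g (actQ w x) = x.
Proof. by rewrite -actQ_mul mulVg actQ1. Qed.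
Lemma actQVK w (x : Q) : actQ w (actQ w^-1%g x) = x.
Proof. by rewrite -actQ_mul mulgV actQ1. Qed.

Lemma tw_expand z : z = \sum_w z w *: delta w.
Proof.
apply/ffunP => x; rewrite twsumE (bigD1 x) //= big1 ?addr0 => [|y yx].
  by rewrite twscaleE deltaE eqxx mulr1.
by rewrite twscaleE deltaE eq_sym (negPf yx) mulr0.
Qed.

Lemma subword_cons i J b (E : {set 'I_(size J)}) :
  subword (I := i :: J) (cons_set b E) = (if b then [:: i] else [::]) ++ subword E.
Proof.
have enumE m (A : {set 'I_m}) : enum A = [seq j <- enum 'I_m | j \in A].
  by rewrite enumT {1}/enum_mem.
have tS k : tnth (in_tuple (i :: J)) (lift ord0 k) = tnth (in_tuple J) k.
  by rewrite !(tnth_nth i).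
rewrite /subword !enumE enum_ordSl /= cons_set0 filter_map.
have -> : [seq k <- enum 'I_(size J) | preim (lift ord0) (mem (cons_set b E)) k] =
    [seq k <- enum 'I_(size J) | k \in E].
  by apply: eq_filter => k /=; rewrite cons_setS.
have tE l : map (tnth (in_tuple (i :: J))) (map (lift ord0) l) = map (tnth (in_tuple J)) l.
  by rewrite -map_comp; apply: eq_map => k; exact: tS.
by case: b; [congr (_ :: _)|]; exact: tE.
Qed.

Lemma Pcoef_cons i J b b' (E F : {set 'I_(size J)}) :
  Pcoef (I := i :: J) (cons_set b E) (cons_set b' F) =
  tw_act (Bfactor (I := i :: J) (cons_set b E) (cons_set b' F) ord0) (Pcoef E F).
Proof.
rewrite /Pcoef; set B := Bfactor _ _.
transitivity (tw_act (B ord0 * \prod_(k < size J) B (lift ord0 k)) 1).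
  by congr (tw_act _ _); exact: big_ord_recl.
apply: etrans (tw_actM _ _ _) _; apply: congr1; apply: (congr1 (fun z => tw_act z 1)).
apply: eq_bigr => k _; rewrite /B /Bfactor !cons_setS.
by rewrite (_ : tnth (in_tuple (i :: J)) (lift ord0 k) = tnth (in_tuple J) k) // !(tnth_nth i).
Qed.

Lemma tw_act_delta (p : Q) w (P : Q) : tw_act (p *: delta w) P = p * actQ w P.
Proof.
rewrite /tw_act (bigD1 w) //= big1 ?addr0 => [|v vw].
  by rewrite twscaleE deltaE eqxx mulr1.
by rewrite twscaleE deltaE (negPf vw) mulr0 mul0r.
Qed.

Lemma tw_act_tau i (P : Q) :
  tw_act (tau i) P = coefp (simple i) * P + coefr (simple i) * actQ (srefl i) P.
Proof.
have D1 (y z : tw) : tw_act (y + z) P = tw_act y P + tw_act z P.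
  by rewrite /tw_act -big_split; apply: eq_bigr => w _; rewrite /= twaddE mulrDl.
rewrite tauE; apply: etrans (D1 _ _) _; congr (_ + _); last exact: tw_act_delta.
by rewrite -[X in coefp _ * X]actQ1; exact: tw_act_delta.
Qed.

Lemma tw_actZ (p : Q) z (P : Q) : tw_act (p *: z) P = p * tw_act z P.
Proof. by rewrite /tw_act mulr_sumr; apply: eq_bigr => w _; rewrite twscaleE mulrA. Qed.

Lemma coef_ratio (F : fieldType) (a d k : F) : d != 0 -> k != 0 ->
  [/\ d / k = (k / d)^-1, (1 - a) / k = - ((a - 1) / d) / (k / d)
    & (a - 1) / k = (a - 1) / d / (k / d)].
Proof. by move=> d0 k0; split; field; rewrite ?d0 ?k0. Qed.

Lemma tw_act_Bfactor i J b b' (E F : {set 'I_(size J)}) (P : Q)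
    (p := coefp (simple i)) (r := coefr (simple i)) :
  tw_act (Bfactor (I := i :: J) (cons_set b E) (cons_set b' F) ord0) P =
  if b && b' then r^-1 * actQ (srefl i) P
  else if b || b' then (- p / r) * actQ (srefl i) P
  else p / r * (p * actQ (srefl i) P + r * P).
Proof.
rewrite /Bfactor !cons_set0 (_ : tnth _ ord0 = i) //.
have [e1 e2 e3] := coef_ratio q (eQ_neq1 (simple i)) (qeQ_neq1 (simple i)).
rewrite e1 e2 e3; case: b b' => [] [] /=; rewrite ?tw_act_delta //.
rewrite tw_actZ tw_actM tw_act_tau; congr (_ * (_ + _)).
  by congr (_ * _); rewrite -[delta _]scale1r tw_act_delta mul1r.
congr (_ * _); rewrite -[delta _]scale1r tw_act_delta mul1r -actQ_mul srefl2.
exact: actQ1.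
Qed.

(** Linear forms on the twisted group algebra, as plain functions: twisting a
    form by a group element stays in this class. *)
Definition qlinear (f : tw -> Q) := forall (a : Q) y z, f (a *: y + z) = a * f y + f z.

Lemma qlinear_delta f w : qlinear f -> qlinear (fun z => actQ w^-1%g (f (delta w * z))).
Proof.
move=> fl a y z.
have -> : delta w * (a *: y + z) = actQ w a *: (delta w * y) + delta w * z.
  apply/ffunP => x; rewrite (delta_mulE w (a *: y + z)) (twaddE _ (delta w * z)).
  by rewrite (twscaleE _ (delta w * y)) !delta_mulE twaddE twscaleE rmorphD rmorphM.
by rewrite fl actQD actQM actQK.
Qed.

(** The product of the forms [f] and [g], evaluated at [z]. *)
Definition diagonal (f g : tw -> Q) z : Q := \sum_w z w * (f (delta w) * g (delta w)).

Lemma delta_tau i z :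
  delta (srefl i) * z = (coefr (simple i))^-1 *: (tau i * z - coefp (simple i) *: z).
Proof.
apply/ffunP => x; rewrite tw_subZE tau_mulE delta_mulE sreflV addrC addKr mulKf //.
exact: coefr_neq0.
Qed.

Lemma qlinear_subZ f (a b : Q) y z : qlinear f ->
  f (b *: (y - a *: z)) = b * (f y - a * f z).
Proof.
move=> fl; have f0 : f 0 = 0.
  by apply: (addrI (1 * f 0)); rewrite -fl scaler0 addr0 mul1r addr0.
have fZ (c : Q) (x : tw) : f (c *: x) = c * f x by rewrite -[c *: x]addr0 fl f0 addr0.
by rewrite fZ addrC -scaleNr fl mulNr addrC.
Qed.

Lemma diagonal_tau i z f g :
  diagonal f g (tau i * z) = coefp (simple i) * diagonal f g z +
   coefr (simple i) * actQ (srefl i) (diagonal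
     (fun y => actQ (srefl i)^-1%g (f (delta (srefl i) * y)))
     (fun y => actQ (srefl i)^-1%g (g (delta (srefl i) * y))) z).
Proof.
rewrite /diagonal mulr_sumr actQ_sum mulr_sumr.
rewrite (reindex_inj (mulgI (srefl i))) [X in X + _](reindex_inj (mulgI (srefl i))) -big_split /=.
have dd w : delta (srefl i) * delta w = delta (srefl i * w)%g.
  by have := delta_mul 1 (srefl i) 1 w; rewrite !scale1r rmorph1 mulr1 scale1r.
apply: eq_bigr => w _; rewrite tau_mulE sreflK mulrDl; congr (_ + _).
  exact: esym (mulrA _ _ _).
apply: etrans (esym (mulrA _ _ _)) _; congr (_ * _).
by rewrite dd !actQM !actQVK.
Qed.

(** Both sides extend [tau_seq J] by one letter [i] in the same way once the value
    of [f] at [delta * y] is rewritten through those at [tau * y] and [y]. *)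
Lemma diagonal_tau_seq I f g : qlinear f -> qlinear g ->
  diagonal f g (tau_seq I) =
  \sum_(E : {set 'I_(size I)}) \sum_(F : {set 'I_(size I)})
    Pcoef E F * f (tau_seq (subword E)) * g (tau_seq (subword F)).
Proof.
elim: I f g => [|i J IH] f g fl gl.
  have e0 (E : {set 'I_(size ([::] : seq 'I_n))}) : E = set0 by apply/setP => -[].
  rewrite (bigD1 set0) //= (bigD1 set0) //= !big1 ?addr0; last 2 first.
  - by move=> E; rewrite (e0 E) eqxx.
  - by move=> E; rewrite (e0 E) eqxx.
  rewrite /Pcoef big_ord0 /subword enum_set0 /= tau_seq_nil.
  rewrite -(scale1r (1 : tw)) tw_act_delta actQ1 mulr1 mul1r scale1r.
  rewrite /diagonal (bigD1 1%g) //= big1 ?addr0 => [|w w1].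
    by rewrite delta1E eqxx mul1r.
  by rewrite delta1E (negPf w1) mul0r.
have fl' := qlinear_delta (srefl i) fl; have gl' := qlinear_delta (srefl i) gl.
rewrite tau_seq_cons diagonal_tau (IH _ _ fl gl) (IH _ _ fl' gl').
rewrite [RHS]big_cons_set mulr_sumr actQ_sum mulr_sumr -big_split; apply: eq_bigr => E _ /=.
rewrite [X in _ = X + _]big_cons_set [X in _ = _ + X]big_cons_set -[RHS]big_split.
rewrite mulr_sumr actQ_sum mulr_sumr -big_split; apply: eq_bigr => F _ /=.
rewrite !Pcoef_cons !tw_act_Bfactor !subword_cons /= !tau_seq_cons.
rewrite !actQM !actQVK !delta_tau !qlinear_subZ //.
exact: coproduct_step (coefr_neq0 _).
Qed.

End Coproduct.

(** * Structure constants of the stable basis *)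

Lemma mul_regroup (F : fieldType) (P a b k l : F) :
  P * (a * k) * (b * l) = k * l * (P * a * b).
Proof. by ring. Qed.

Lemma scalar_ratio (F : fieldType) (a b d x s : F) : d != 0 ->
  a * x * (b * x) * s = a * b / d * x * s * (d * x).
Proof. by move=> d0; field; rewrite d0. Qed.

Lemma big_support2 (V : nmodType) (T T' : finType) (P : pred T) (P' : pred T') (F : T -> T' -> V) :
  (forall t t', F t t' != 0 -> P t && P' t') ->
  \sum_t \sum_t' F t t' = \sum_(t | P t) \sum_(t' | P' t') F t t'.
Proof.
move=> FP; have F0 t t' : ~~ (P t && P' t') -> F t t' = 0.
  by move=> h; apply/eqP; apply: contraNT h => /FP.
rewrite [RHS]big_mkcond; apply: eq_bigr => t _; case: ifP => Pt.
  rewrite [RHS]big_mkcond; apply: eq_bigr => t' _.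
  by case: ifP => // P't'; rewrite F0 // Pt P't'.
by rewrite big1 // => t' _; rewrite F0 // Pt.
Qed.

Section Structure.
Context (D : root_datum).
Local Notation W := (weyl D).
Local Notation n := (nsimple D).
Local Notation Q := (Qm D).
Local Notation q := (q D).
Local Notation qh := (qh D).
Local Notation tw := (twisted D).
Implicit Types (i j : 'I_n) (u v w x : W) (z : tw) (f g : twisted_dual D).
Local Opaque weyl_perm ropp w0 weyl_inv tau tau_seq stab Pcoef hatx.

Lemma dual_linear f : qlinear (f : tw -> Q).
Proof. by move=> a y z; rewrite linearP. Qed.

Lemma dualZ (a : Q) f z : (a *: f) z = a * f z.
Proof. exact: scale_lfunE. Qed.

Lemma dual_mul_diagonal f g z : dual_mul f g z = diagonal (f : tw -> Q) (g : tw -> Q) z.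
Proof.
rewrite /dual_mul sum_lfunE; apply: eq_bigr => w _.
by rewrite dualZ fdualE mulrC.
Qed.

Lemma dual_expand f z : f z = \sum_x z x * f (delta x).
Proof.
rewrite {1}[z]tw_expand linear_sum; apply: eq_bigr => x _; exact: linearZ.
Qed.

(** The basis [tau_weyl] is triangular over the basis [delta] for the Bruhat
    order, so a form that is nonzero at [delta x] is already nonzero at some
    [tau_weyl y] below it. *)
Lemma dual_delta_neq0 f x : f (delta x) != 0 ->
  exists2 y, bruhat y x & f (tau_weyl y) != 0.
Proof.
elim: {x}(len x).+1 {-2}x (ltnSn (len x)) => // k IH x lx fx.
case: (eqVneq (f (tau_weyl x)) 0) => [f0|]; last by exists x => //; exact: bruhat_refl.
have [y /andP[yx ty] fy] : exists2 y, (y != x) && (tau_weyl x y != 0) & f (delta y) != 0.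
  apply: contrapT => H; have := dual_expand f (tau_weyl x).
  rewrite f0 (bigD1 x) //= tau_weyl_lead big1 ?addr0 => [/esym/eqP|y yx].
    by rewrite mulf_eq0 (negPf (lead_neq0 x)) (negPf fx).
  apply/eqP; rewrite mulf_eq0; apply/negPn; rewrite negb_or; apply/negP => /andP[ty fy].
  exact: (H (ex_intro2 _ _ y (introT andP (conj yx ty)) fy)).
have byx := tau_weyl_support ty; have lyx : (len y < len x)%N.
  by case: (bruhat_len byx) => // e; rewrite e eqxx in yx.
have [y' by'y fy'] := IH y (leq_trans lyx lx) fy.
by exists y' => //; exact: bruhat_trans by'y byx.
Qed.

Lemma dual_eq f g : (forall w, f (tau_weyl w) = g (tau_weyl w)) -> f = g.
Proof.
move=> fg; apply/lfunP => z; rewrite !dual_expand; apply: eq_bigr => x _; congr (_ * _).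
apply/eqP; rewrite -subr_eq0; apply/negPn/negP => h.
have [|y _] := @dual_delta_neq0 (f - g) x; first by rewrite add_lfunE opp_lfunE.
by rewrite add_lfunE opp_lfunE fg subrr eqxx.
Qed.

Context (c : seq 'I_n -> W -> Rm)
  (hc : forall I, tau_seq I = \sum_w cstQ D (c I w) *: tau_weyl w).

Let kappa u : Q := qh ^+ len u * hatx (w0 D).

Lemma kappa_neq0 u : kappa u != 0.
Proof. exact: mulf_neq0 (expf_neq0 _ (qh_neq0 D)) (hatx_neq0 _). Qed.

Lemma stab_delta u x : stab u (delta x) != 0 -> bruhat u x.
Proof.
case/dual_delta_neq0=> y yx; rewrite (stab_tau_weyl hc).
by case: (u =P y) => [->//|_]; rewrite mul0r eqxx.
Qed.

Lemma stab_tau_seq u I : stab u (tau_seq I) = cstQ D (c I u) * kappa u.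
Proof.
rewrite hc linear_sum (bigD1 u) //= big1 ?addr0 => [|w wu].
  by rewrite linearZ /= (stab_tau_weyl hc) eqxx mul1r.
by rewrite linearZ /= (stab_tau_weyl hc) eq_sym (negPf wu) mul0r scaler0.
Qed.

(** The support of [tau_seq I] lies below [demazure I], and [stab u] only detects
    the part of it above [u]. *)
Lemma coefficient_demazure I u : cstQ D (c I u) != 0 -> bruhat u (demazure I).
Proof.
move=> cu; have : stab u (tau_seq I) != 0 by rewrite stab_tau_seq; exact: mulf_neq0 (kappa_neq0 _).
move=> su; have [x tx sx] : exists2 x, tau_seq I x != 0 & stab u (delta x) != 0.
  apply: contrapT => H; case/eqP: su; rewrite dual_expand big1 // => x _.
  apply/eqP; rewrite mulf_eq0; apply/negPn; rewrite negb_or; apply/negP => /andP[tx sx].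
  exact: (H (ex_intro2 _ _ x tx sx)).
exact: bruhat_trans (stab_delta sx) (subproduct_demazure (tau_seq_support tx)).
Qed.

Lemma stab_mul_support u v w : dual_mul (stab u) (stab v) (tau_weyl w) != 0 ->
  bruhat u w && bruhat v w.
Proof.
rewrite dual_mul_diagonal /diagonal => nz.
have [x tx sx] : exists2 x, tau_weyl w x != 0 & (stab u (delta x) != 0) && (stab v (delta x) != 0).
  apply: contrapT => H; case/eqP: nz; rewrite big1 // => x _.
  apply/eqP; rewrite !mulf_eq0; apply/negPn; rewrite !negb_or; apply/negP => /andP[tx sx].
  exact: (H (ex_intro2 _ _ x tx sx)).
case/andP: sx => su sv; have xw := tau_weyl_support tx.
by rewrite (bruhat_trans (stab_delta su) xw) (bruhat_trans (stab_delta sv) xw).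
Qed.

Lemma stab_sum_tau (P : pred W) (p : W -> Q) w :
  (\sum_(x | P x) p x *: stab x) (tau_weyl w) = if P w then p w * kappa w else 0.
Proof.
rewrite sum_lfunE; case Pw: (P w).
  rewrite (bigD1 w) //= big1 ?addr0 => [|x /andP[_ xw]].
    by rewrite dualZ (stab_tau_weyl hc) eqxx mul1r.
  by rewrite dualZ (stab_tau_weyl hc) (negPf xw) mul0r mulr0.
rewrite big1 // => x Px; rewrite dualZ (stab_tau_weyl hc).
by case: (x =P w) => [e|_]; [rewrite e Pw in Px | rewrite mul0r mulr0].
Qed.

Lemma stab_mul_expand u v :
  dual_mul (stab u) (stab v) = \sum_(w | bruhat u w && bruhat v w)
    (dual_mul (stab u) (stab v) (tau_weyl w) / kappa w) *: stab w.
Proof.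
apply: dual_eq => w; rewrite stab_sum_tau.
case: ifP => [_|/negbT h]; first by rewrite (divfK (kappa_neq0 w)).
by apply/eqP/negPn/negP => /stab_mul_support; rewrite (negPf h).
Qed.

Lemma stab_mul_tau_seq u v I :
  dual_mul (stab u) (stab v) (tau_seq I) = kappa u * kappa v *
  \sum_(E : {set 'I_(size I)} | bruhat u (demazure (subword E)))
    \sum_(F : {set 'I_(size I)} | bruhat v (demazure (subword F)))
      Pcoef E F * cstQ D (c (subword E) u) * cstQ D (c (subword F) v).
Proof.
rewrite dual_mul_diagonal (diagonal_tau_seq I (@dual_linear _) (@dual_linear _)).
pose t (E F : {set 'I_(size I)}) := Pcoef E F * cstQ D (c (subword E) u) * cstQ D (c (subword F) v).
transitivity (\sum_(E : {set 'I_(size I)}) \sum_(F : {set 'I_(size I)})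
    kappa u * kappa v * t E F).
  apply: eq_bigr => E _; apply: eq_bigr => F _; apply: etrans (mul_regroup _ _ _ _ _).
  by congr (_ * _ * _); exact: stab_tau_seq.
under eq_bigr do rewrite -mulr_sumr; rewrite -mulr_sumr; congr (_ * _).
apply: big_support2 => E F; rewrite /t !mulf_eq0 !negb_or -andbA => /and3P[_ cE cF].
by apply/andP; split; [exact: coefficient_demazure cE | exact: coefficient_demazure cF].
Qed.

End Structure.

Theorem theorem7p4 (D : root_datum)
    (c : seq 'I_(nsimple D) -> weyl D -> Rm)
    (hc : forall I : seq 'I_(nsimple D),
      tau_seq I = \sum_w cstQ D (c I w) *: tau_weyl w) :
  let expansion (p : weyl D -> weyl D -> weyl D -> Qm D) :=
    forall u v : weyl D, dual_mul (stab u) (stab v) =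
      \sum_(w | bruhat u w && bruhat v w) p u v w *: stab w in
  (exists p, expansion p) /\
  (forall p, expansion p ->
   forall Iw : weyl D -> seq 'I_(nsimple D),
   (forall w, reduced_word (Iw w) w) ->
   forall u v w : weyl D, bruhat u w -> bruhat v w ->
   p u v w =
     qh D ^ ((len u)%:Z + (len v)%:Z - (len w)%:Z) * hatx (w0 D) *
     \sum_(E : {set 'I_(size (Iw w))} | bruhat u (demazure (subword E)))
       \sum_(F : {set 'I_(size (Iw w))} | bruhat v (demazure (subword F)))
         Pcoef E F * cstQ D (c (subword E) u) * cstQ D (c (subword F) v)).
Proof.
move=> expansion; split.
  exists (fun u v w => dual_mul (stab u) (stab v) (tau_weyl w) / (qh D ^+ len w * hatx (w0 D))).
  exact: (stab_mul_expand hc).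
move=> p pE Iw rIw u v w uw vw; set S := \sum_(E | _) _.
have h0 := qh_neq0 D; have x0 := hatx_neq0 (w0 D).
have kw : qh D ^+ len w * hatx (w0 D) != 0 by exact: mulf_neq0 (expf_neq0 _ h0) x0.
have e : p u v w * (qh D ^+ len w * hatx (w0 D)) =
    (qh D ^+ len u * hatx (w0 D)) * (qh D ^+ len v * hatx (w0 D)) * S.
  rewrite -(stab_mul_tau_seq hc) (tau_reduced hc (rIw w)) (pE u v) (stab_sum_tau hc).
  by rewrite uw vw.
apply: (mulIf kw); rewrite e; rewrite (expfzDr _ _ h0) (expfzDr _ _ h0) -exprnN.
exact: scalar_ratio (expf_neq0 _ h0).
Qed.
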